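(* Let $d\ge2$, $\varepsilon\in(0,\tfrac12]$ and let $P$ be a set of $n$ points in $\mathbb{H}^d$. There is a Steiner $(1+\varepsilon)$-spanner for $P$ with Steiner vertex set $Q$ that is bipartite on $P$ and $Q$, in which every point of $P$ has degree at most $d^{O(d)}\,\varepsilon^{(1-d)/2}\log\frac1\varepsilon$ when $d\ge3$, and at most $O\!\left(\frac1\varepsilon\log\frac1\varepsilon\right)$ when $d=2$.
   Context: $\mathbb{H}^d$ is hyperbolic $d$-space of curvature $-1$. A Steiner $t$-spanner for finite $P$ is a geometric graph $G$ (edges weighted by distance of endpoints) on $P\cup Q$, $Q$ finite and disjoint from $P$, with $\mathrm{dist}_G(u,v)\le t|uv|$ for all $u,v\in P$; it is bipartite on $P$ and $Q$ if every edge joins a point of $P$ to a point of $Q$. $O(\cdot)$ constants are absolute. *)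

(* Defs.v *)
From HB Require Import structures.
From mathcomp Require Import all_boot all_order all_algebra.
From mathcomp Require Import reals exp.
Set Implicit Arguments. Unset Strict Implicit. Unset Printing Implicit Defensive.
Import Order.TTheory GRing.Theory Num.Theory.
Local Open Scope ring_scope.

(* Hyperbolic d-space H^d (curvature -1), hyperboloid model in R^{d+1}. *)
Section Hyp.
Variables (R : realType) (d : nat).

Definition hpoint := 'rV[R]_(d.+1).

Definition minkowski (x y : hpoint) : R :=
  \sum_(i < d.+1) (if i == ord0 then -1 else 1) * x 0 i * y 0 i.

Definition in_Hd (x : hpoint) : bool := (minkowski x x == -1) && (0 < x 0 ord0).

Definition arcosh (t : R) : R := ln (t + Num.sqrt (t ^+ 2 - 1)).
Definition hdist (x y : hpoint) : R := arcosh (- minkowski x y).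

Definition adjacent (E : seq (hpoint * hpoint)) (a b : hpoint) : bool :=
  ((a, b) \in E) || ((b, a) \in E).

Fixpoint walk_length (x : hpoint) (s : seq hpoint) : R :=
  if s is y :: s' then hdist x y + walk_length y s' else 0.

(* dist_G(u,v) <= L : some walk in G from u to v has length <= L
   (the graph distance is the minimum of walk lengths over finitely many
   simple paths, so this is exactly dist_G(u,v) <= L). *)
Definition graph_dist_le (E : seq (hpoint * hpoint)) (u v : hpoint) (L : R) : Prop :=
  exists s : seq hpoint, [/\ path (adjacent E) u s, last u s = v & walk_length u s <= L].

Definition bipartite_steiner_spanner (t : R) (P Q : seq hpoint)
    (E : seq (hpoint * hpoint)) : Prop :=
  [/\ all in_Hd Q,
      all (fun q => q \notin P) Q,
      all (fun e => (e.1 \in P) && (e.2 \in Q)) E &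
      forall u v, u \in P -> v \in P -> graph_dist_le E u v (t * hdist u v)].

Definition degree (E : seq (hpoint * hpoint)) (p : hpoint) : nat :=
  size (undup ([seq e.2 | e <- E & e.1 == p] ++ [seq e.1 | e <- E & e.2 == p])).

End Hyp.

(* Main.v *)
Require Import Defs.
From HB Require Import structures.
From mathcomp Require Import all_boot all_order all_algebra.
From mathcomp Require Import boolp reals sequences exp.
From mathcomp Require Import ring lra zify.
Set Implicit Arguments. Unset Strict Implicit. Unset Printing Implicit Defensive.
Import Order.TTheory GRing.Theory Num.Theory.
Local Open Scope ring_scope.

(* In half-space coordinates, the geodesic between two points at distance about L crosses a
   horosphere or a vertical hyperplane of a grid attached to a scale-dependent box around both
   points, far from both endpoints. A point of the crossed hypersurface within sqrt (eps L)
   (times min (1, sqrt L)) of the crossing lengthens the path by only O(eps L), so a grid of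
   codimension one suffices. Its points, the hubs, are named by their coordinates modulo the
   size of the window in which a point of P looks for them; hence a name determines the hub
   from either endpoint, and even from any point near an endpoint. There are
   d^O(d) eps^((1-d)/2) names (O(1/eps) when d = 2): for L >= 1 the height of the hub costs a
   factor L, while the coarser grid gains L^((1-d)/2). Once eps L exceeds O(d), a single hub
   above both points suffices, with its log-height rounded to a multiple of eps L / 16.

   For a fixed name and a fixed residue of log2 L modulo O(log (d / eps)), clusters are merged
   at a common hub, scale by scale. Each cluster keeps two free slots among its points, so each
   such hierarchy costs degree at most 2, and a point and the representative of its cluster
   share hubs because names are robust. *)

(** The obstacle is the number of scales: it depends on [P], so giving each point one edge per scale
    and name would make the degree depend on [P] too. Letting a cluster act as one vertex avoids
    this at a price. At scale L the clusters need radius at most theta L, with theta of order eps /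
    d, for the detour inside them to fit the error; but clusters joined through a hub at distance
    O(L) get radius O(L). A hierarchy can therefore use its clusters again only at a scale about 1 /
    theta times larger, and the scales it skips need hierarchies of their own. Their number, bounded
    by O(d log (1 / eps)), is the logarithm in the degree. The square root of eps comes from the
    tangent bound for arcosh at both endpoints: the first-order terms in the offset of the hub from
    the geodesic cancel, and what remains is proportional to cosh of the offset minus 1, hence
    quadratic for small offsets. *)

(** * Hyperbolic cosine and its inverse *)

Section HyperbolicCosine.
Variable R : realType.
Implicit Types a b t x y z : R.

Definition cosh x : R := (expR x + expR (- x)) / 2.
Definition sinh x : R := (expR x - expR (- x)) / 2.

Lemma cosh0 : cosh 0 = 1.
Proof. by rewrite /cosh oppr0 expR0; lra. Qed.

Lemma coshN x : cosh (- x) = cosh x.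
Proof. by rewrite /cosh opprK addrC. Qed.

Lemma sinh2E x : sinh x ^+ 2 = cosh x ^+ 2 - 1.
Proof.
have := expRxMexpNx_1 x; rewrite /cosh /sinh; set u := expR x; set v := expR (- x).
by move=> h; rewrite -[X in _ = _ - X]h; field.
Qed.

Lemma coshD x y : cosh (x + y) = cosh x * cosh y + sinh x * sinh y.
Proof. by rewrite /cosh /sinh opprD !expRD; field. Qed.

Lemma sinh_ge0 x : 0 <= x -> 0 <= sinh x.
Proof.
move=> x0; have : expR (- x) <= expR x by rewrite ler_expR; lra.
by rewrite /sinh; lra.
Qed.

(** Convexity: 1 + t <= exp t and 1 - t <= exp (- t), weighted by exp x and exp (- x), add up to
    this. *)
Lemma cosh_tangent x t : cosh x + t * sinh x <= cosh (x + t).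
Proof.
rewrite /cosh /sinh opprD !expRD.
have := expR_ge1Dx t; have := expR_ge1Dx (- t).
have := expR_gt0 x; have := expR_gt0 (- x).
by set u := expR x; set v := expR (- x); set w := expR t; set z := expR (- t); nra.
Qed.

Lemma cosh_ge1 x : 1 <= cosh x.
Proof. by have := cosh_tangent 0 x; rewrite cosh0 /sinh oppr0 subrr mul0r mulr0 addr0 add0r. Qed.

Lemma cosh_lt x y : 0 <= x -> x < y -> cosh x < cosh y.
Proof.
move=> x0 xy; have := expRxMexpNx_1 x; have := expRxMexpNx_1 y.
have : expR x < expR y by rewrite ltr_expR.
have : 1 <= expR x by rewrite -expR0 ler_expR.
rewrite /cosh; have := expR_gt0 (- x); have := expR_gt0 (- y).
set u := expR x; set v := expR (- x); set w := expR y; set z := expR (- y).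
move=> z0 v0 u1 uw wz uv.
have w0 : 0 < w by lra.
have u0 : 0 < u by lra.
have -> : v = u^-1 by rewrite -[LHS]mul1r -(mulVf (lt0r_neq0 u0)) -mulrA uv mulr1.
have -> : z = w^-1 by rewrite -[LHS]mul1r -(mulVf (lt0r_neq0 w0)) -mulrA wz mulr1.
rewrite -subr_gt0.
have -> : (w + w^-1) / 2 - (u + u^-1) / 2 = (w - u) * (w * u - 1) / (2 * u * w).
  by field; rewrite !gt_eqF.
by apply: divr_gt0; [apply: mulr_gt0 |]; nra.
Qed.

Lemma cosh_le x y : 0 <= x -> x <= y -> cosh x <= cosh y.
Proof. by move=> x0; rewrite le_eqVlt => /orP[/eqP->//|/(cosh_lt x0)/ltW]. Qed.

Lemma cosh_le_expR x : 0 <= x -> cosh x <= expR x.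
Proof.
move=> x0; have : expR (- x) <= expR x by rewrite ler_expR; lra.
by rewrite /cosh; lra.
Qed.

Lemma cosh_ln x : 0 < x -> cosh (ln x) = (x + x^-1) / 2.
Proof. by move=> x0; rewrite /cosh expRN lnK. Qed.

Lemma sqr_sub1_ge0 t : 1 <= t -> 0 <= t ^+ 2 - 1.
Proof. by move=> t1; nra. Qed.

Lemma arcosh_ge0 t : 1 <= t -> 0 <= arcosh t.
Proof. by move=> t1; apply: ln_ge0; have := sqrtr_ge0 (t ^+ 2 - 1); lra. Qed.

Lemma cosh_arcosh t : 1 <= t -> cosh (arcosh t) = t.
Proof.
move=> t1; have h := sqr_sqrtr (sqr_sub1_ge0 t1).
have s0 := sqrtr_ge0 (t ^+ 2 - 1).
rewrite /arcosh cosh_ln; last lra.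
by move: s0 h; set s := Num.sqrt _ => s0 h; apply/eqP; rewrite -subr_eq0; apply/eqP;
  have -> : (t + s + (t + s)^-1) / 2 - t = (s ^+ 2 - (t ^+ 2 - 1)) / (2 * (t + s));
  [field; rewrite gt_eqF //; lra | rewrite h subrr mul0r].
Qed.

Lemma sinh_arcosh t : 1 <= t -> sinh (arcosh t) = Num.sqrt (t ^+ 2 - 1).
Proof.
move=> t1; rewrite -[in RHS](cosh_arcosh t1) -sinh2E sqrtr_sqr ger0_norm //.
by apply/sinh_ge0/arcosh_ge0.
Qed.

Lemma arcosh_le t x : 1 <= t -> 0 <= x -> t <= cosh x -> arcosh t <= x.
Proof.
move=> t1 x0 tx; rewrite leNgt; apply/negP => /(cosh_lt x0).
by rewrite cosh_arcosh // ltNge tx.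
Qed.

Lemma le_arcosh t x : 1 <= t -> cosh x <= t -> x <= arcosh t.
Proof.
move=> t1 xt; rewrite leNgt; apply/negP => /(cosh_lt (arcosh_ge0 t1)).
by rewrite cosh_arcosh // ltNge xt.
Qed.

Lemma arcosh1 : arcosh (1 : R) = 0.
Proof. by rewrite /arcosh expr1n subrr sqrtr0 addr0 ln1. Qed.

(* The tangent bound cosh (a + x) >= cosh a + x sinh a linearizes arcosh. *)
Lemma arcosh_tangent t a x : 1 <= t -> 0 < sinh a -> 0 <= a ->
  t - cosh a <= x * sinh a -> arcosh t <= a + x.
Proof.
move=> t1 s0 a0 h.
have ax0 : 0 <= a + x.
  have := cosh_tangent a (- a); rewrite subrr cosh0 => h0.
  by have : 0 <= (a + x) * sinh a; [nra | rewrite pmulr_lge0].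
by apply: arcosh_le => //; apply: le_trans (cosh_tangent a x); lra.
Qed.

(** Since x <= 2, both 1 + x / 2 and 1 - x / 2 are nonnegative, so the tangent bounds for exp (x /
    2) and exp (- x / 2) may be squared; the linear terms then cancel. *)
Lemma cosh_ge_quadratic x : 0 <= x <= 2 -> 1 + x ^+ 2 / 4 <= cosh x.
Proof.
move=> /andP[x0 x2].
have e1 := expR_ge1Dx (x / 2); have e2 := expR_ge1Dx (- (x / 2)).
have -> : cosh x = (expR (x / 2) ^+ 2 + expR (- (x / 2)) ^+ 2) / 2.
  by rewrite /cosh !expr2 -!expRD; congr ((expR _ + expR _) / _); field.
by nra.
Qed.

Lemma cosh_le_quadratic x : 0 <= x -> cosh x - 1 <= x ^+ 2 * expR x / 2.
Proof.
move=> x0; have e1 := expR_ge1Dx (- x); have e0 := expR_gt0 x.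
have xe := expRxMexpNx_1 x.
have b : expR x - 1 <= x * expR x by nra.
have b1 : 0 <= expR x - 1 by have := expR_ge1Dx x; lra.
have -> : cosh x - 1 = expR (- x) * (expR x - 1) ^+ 2 / 2.
  have -> : expR (- x) * (expR x - 1) ^+ 2 =
     (expR x * expR (- x)) * expR x - 2 * (expR x * expR (- x)) + expR (- x) by ring.
  by rewrite xe /cosh; field.
have -> : x ^+ 2 * expR x / 2 = expR (- x) * (x * expR x) ^+ 2 / 2.
  have -> : expR (- x) * (x * expR x) ^+ 2 = (expR x * expR (- x)) * (x ^+ 2 * expR x) by ring.
  by rewrite xe mul1r.
apply: ler_wpM2r; first by rewrite invr_ge0 ler0n.
apply: ler_wpM2l; first exact: expR_ge0.
by rewrite ler_sqr // nnegrE; nra.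
Qed.

Lemma expR1_le4 : expR 1 <= 4 :> R.
Proof.
have e1 := expR_ge1Dx (- 2^-1 : R); have e0 := expR_gt0 (2^-1 : R).
have xe := expRxMexpNx_1 (2^-1 : R).
have -> : expR 1 = expR (2^-1) ^+ 2 :> R by rewrite expr2 -expRD; congr expR; field.
have : expR (2^-1 : R) <= 2 by nra.
by nra.
Qed.

End HyperbolicCosine.

(** * Half-space coordinates *)

Section HalfSpace.
Variables (R : realType) (m : nat).
Notation T := (hpoint R m.+1).
Implicit Types p q u v w : T.

(** Minus the Minkowski product with the null vector (1, 1, 0, ..., 0): the level sets are the
    horospheres at one ideal point, which becomes infinity in the half-space chart. *)
Definition depth p : R := p 0 ord0 - p 0 (lift ord0 ord0).
Definition ht p : R := (depth p)^-1.
Definition hx p (j : 'I_m) : R := p 0 (lift ord0 (lift ord0 j)) / depth p.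

Definition dx2 p q : R := \sum_j (hx p j - hx q j) ^+ 2.
(** The upper half-space formula for cosh of the hyperbolic distance. *)
Definition ch p q : R := 1 + (dx2 p q + (ht p - ht q) ^+ 2) / (2 * ht p * ht q).

(* The inverse chart: the point with horizontal coordinates X and height y. *)
Definition mkH (X : 'I_m -> R) (y : R) : T :=
  \row_i (if unlift ord0 i is Some i' then
            if unlift ord0 i' is Some j then X j / y
            else (y ^+ 2 + \sum_j X j ^+ 2 - 1) / (2 * y)
          else (y ^+ 2 + \sum_j X j ^+ 2 + 1) / (2 * y)).

Lemma minkowskiE p q : minkowski p q =
  - (p 0 ord0 * q 0 ord0) + p 0 (lift ord0 ord0) * q 0 (lift ord0 ord0)
  + \sum_(j < m) p 0 (lift ord0 (lift ord0 j)) * q 0 (lift ord0 (lift ord0 j)).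
Proof.
rewrite /minkowski 2!big_ord_recl !eqxx /= addrA; congr (_ + _ + _).
- by rewrite mulN1r mulNr.
- by rewrite mul1r.
- by apply: eq_bigr => j _; rewrite mul1r.
Qed.

Lemma depth_gt0 p : in_Hd p -> 0 < depth p.
Proof.
case/andP=> /eqP; rewrite minkowskiE /depth => h p0.
have : 0 <= \sum_(j < m) p 0 (lift ord0 (lift ord0 j)) * p 0 (lift ord0 (lift ord0 j)).
  by apply: sumr_ge0 => j _; rewrite -expr2 sqr_ge0.
by move: h p0; set s := \sum_(j < m) _; set a := p 0 ord0; set b := p 0 _; nra.
Qed.

Lemma ht_gt0 p : in_Hd p -> 0 < ht p.
Proof. by move=> /depth_gt0; rewrite /ht invr_gt0. Qed.

(** The hyperboloid equation, with its first two squares factored as a difference of squares,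
    multiplied by [ht p ^+ 2]. *)
Lemma in_Hd_sum p : in_Hd p ->
  (p 0 ord0 + p 0 (lift ord0 ord0)) * ht p = ht p ^+ 2 + \sum_j hx p j ^+ 2.
Proof.
move=> pH; have a0 := depth_gt0 pH; case/andP: pH => /eqP + _.
rewrite minkowskiE => h.
have -> : \sum_j hx p j ^+ 2 =
  (\sum_(j < m) p 0 (lift ord0 (lift ord0 j)) * p 0 (lift ord0 (lift ord0 j))) * ht p ^+ 2.
  by rewrite mulr_suml; apply: eq_bigr => j _; rewrite /hx /ht exprMn -expr2.
move: h a0; rewrite /ht /depth; set s := \sum_(j < m) _; set a := p 0 ord0; set b := p 0 _.
move=> h a0; have -> : s = -1 + a * a - b * b by lra.
by field; rewrite gt_eqF.
Qed.

Lemma minkowski_ch p q : in_Hd p -> in_Hd q -> - minkowski p q = ch p q.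
Proof.
move=> pH qH; have pa := depth_gt0 pH; have qa := depth_gt0 qH.
have := in_Hd_sum pH; have := in_Hd_sum qH.
have -> : minkowski p q = - (p 0 ord0 * q 0 ord0) + p 0 (lift ord0 ord0) * q 0 (lift ord0 ord0)
  + (\sum_j hx p j * hx q j) / (ht p * ht q).
  rewrite minkowskiE; congr (_ + _); rewrite mulr_suml; apply: eq_bigr => j _.
  by rewrite /hx /ht; field; rewrite !gt_eqF.
have -> : ch p q = 1 + (\sum_j hx p j ^+ 2 + \sum_j hx q j ^+ 2
  - 2 * (\sum_j hx p j * hx q j) + (ht p - ht q) ^+ 2) / (2 * ht p * ht q).
  rewrite /ch; congr (1 + (_ + _) / _); rewrite mulr_sumr -big_split -sumrB /=.
  by apply: eq_bigr => j _; ring.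
set sp := \sum_j hx p j ^+ 2; set sq := \sum_j hx q j ^+ 2; set c := \sum_j _ * _.
move: pa qa; rewrite /ht /depth; set a := p 0 ord0; set b := p 0 _.
set a' := q 0 ord0; set b' := q 0 _ => pa qa hq hp.
have -> : sq = (a' + b') / (a' - b') - (a' - b')^-1 ^+ 2 by rewrite hq; ring.
have -> : sp = (a + b) / (a - b) - (a - b)^-1 ^+ 2 by rewrite hp; ring.
by field; rewrite !gt_eqF.
Qed.

Lemma hdistE p q : in_Hd p -> in_Hd q -> hdist p q = arcosh (ch p q).
Proof. by move=> pH qH; rewrite /hdist minkowski_ch. Qed.

Lemma depth_mkH X y : 0 < y -> depth (mkH X y) = y^-1.
Proof.
move=> y0; rewrite /depth !mxE unlift_none liftK unlift_none.
by field; rewrite gt_eqF.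
Qed.

Lemma ht_mkH X y : 0 < y -> ht (mkH X y) = y.
Proof. by move=> y0; rewrite /ht depth_mkH // invrK. Qed.

Lemma hx_mkH X y j : 0 < y -> hx (mkH X y) j = X j.
Proof.
move=> y0; rewrite /hx depth_mkH // !mxE !liftK invrK.
by rewrite mulfVK // gt_eqF.
Qed.

Lemma mkH_in X y : 0 < y -> in_Hd (mkH X y).
Proof.
move=> y0; have S0 : 0 <= \sum_j X j ^+ 2 by apply: sumr_ge0 => j _; rewrite sqr_ge0.
apply/andP; split.
  rewrite minkowskiE !mxE unlift_none liftK unlift_none.
  have -> : \sum_(j < m) mkH X y 0 (lift ord0 (lift ord0 j)) * mkH X y 0 (lift ord0 (lift ord0 j))
     = (\sum_j X j ^+ 2) / y ^+ 2.
    rewrite mulr_suml; apply: eq_bigr => j _; rewrite !mxE !liftK.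
    by field; rewrite gt_eqF.
  by apply/eqP; field; rewrite gt_eqF.
rewrite !mxE unlift_none; apply: divr_gt0; last by rewrite mulr_gt0.
by have := sqr_ge0 y; lra.
Qed.

Lemma dx2_ge0 p q : 0 <= dx2 p q.
Proof. by apply: sumr_ge0 => j _; rewrite sqr_ge0. Qed.

Lemma dx2C p q : dx2 p q = dx2 q p.
Proof. by apply: eq_bigr => j _; rewrite -sqrrN opprB. Qed.

Lemma chC p q : ch p q = ch q p.
Proof.
rewrite /ch dx2C -sqrrN opprB; congr (1 + _ / _).
by rewrite -!mulrA [ht p * _]mulrC.
Qed.

Lemma ch_ge1 p q : in_Hd p -> in_Hd q -> 1 <= ch p q.
Proof.
move=> /ht_gt0 p0 /ht_gt0 q0; rewrite /ch lerDl divr_ge0 //.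
  by rewrite addr_ge0 ?sqr_ge0 ?dx2_ge0.
by rewrite !mulr_ge0 ?ltW.
Qed.

Lemma cosh_hdist p q : in_Hd p -> in_Hd q -> cosh (hdist p q) = ch p q.
Proof. by move=> pH qH; rewrite hdistE // cosh_arcosh // ch_ge1. Qed.

Lemma hdist_ge0 p q : in_Hd p -> in_Hd q -> 0 <= hdist p q.
Proof. by move=> pH qH; rewrite hdistE // arcosh_ge0 // ch_ge1. Qed.

Lemma hdistC p q : in_Hd p -> in_Hd q -> hdist p q = hdist q p.
Proof. by move=> pH qH; rewrite !hdistE // chC. Qed.

Lemma hdistxx p : in_Hd p -> hdist p p = 0.
Proof.
move=> pH; rewrite hdistE // /ch.
have -> : dx2 p p = 0 by rewrite /dx2 big1 // => j _; rewrite subrr expr0n.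
by rewrite subrr expr0n add0r mul0r addr0 arcosh1.
Qed.

Lemma in_Hd_eq p q : in_Hd p -> in_Hd q -> ht p = ht q -> hx p =1 hx q -> p = q.
Proof.
move=> pH qH hE xE; have dE : depth p = depth q by apply: invr_inj.
have p0 := depth_gt0 pH.
have tail j : p 0 (lift ord0 (lift ord0 j)) = q 0 (lift ord0 (lift ord0 j)).
  by have := xE j; rewrite /hx dE => /(mulIf _) -> //; rewrite invr_eq0 -dE gt_eqF.
have sE : p 0 ord0 + p 0 (lift ord0 ord0) = q 0 ord0 + q 0 (lift ord0 ord0).
  have := in_Hd_sum pH; rewrite hE (eq_bigr (fun j => hx q j ^+ 2)); last by move=> j _; rewrite xE.
  by rewrite -(in_Hd_sum qH) => /(mulIf _) -> //; rewrite gt_eqF // ht_gt0.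
move: dE; rewrite /depth => dE.
apply/rowP => i; case: (unliftP ord0 i) => [i' ->|->]; last by lra.
by case: (unliftP ord0 i') => [j ->|->]; [exact: tail | lra].
Qed.

Lemma hdist_eq0 p q : in_Hd p -> in_Hd q -> hdist p q = 0 -> p = q.
Proof.
move=> pH qH h; have := cosh_hdist pH qH; rewrite h cosh0 /ch => /eqP.
have p0 := ht_gt0 pH; have q0 := ht_gt0 qH.
rewrite -subr_eq0 opprD addrA subrr add0r oppr_eq0 mulf_eq0 invr_eq0.
rewrite (gt_eqF (mulr_gt0 (mulr_gt0 (ltr0Sn R 1) p0) q0)) orbF.
rewrite paddr_eq0 ?dx2_ge0 ?sqr_ge0 // => /andP[d0]; rewrite expf_eq0 /= subr_eq0 => /eqP hE.
apply: in_Hd_eq => // j; move: d0; rewrite /dx2 psumr_eq0; last by move=> i _; rewrite sqr_ge0.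
by move=> /allP /(_ j (mem_index_enum j)); rewrite /= expf_eq0 /= subr_eq0 => /eqP.
Qed.

(** The vectors are (a0, a) and (b0, b), of norms A and B: expand |B a + A b|^2 >= 0 and divide by 2
    A B. The division fails for a zero norm, but then that vector vanishes. *)
Lemma cauchy_schwarz (a b : 'I_m -> R) (a0 b0 A B : R) :
  A ^+ 2 = a0 ^+ 2 + \sum_j a j ^+ 2 -> B ^+ 2 = b0 ^+ 2 + \sum_j b j ^+ 2 -> 0 <= A -> 0 <= B ->
  - (a0 * b0 + \sum_j a j * b j) <= A * B.
Proof.
move=> hA hB A0 B0.
have key : 0 <= (B * a0 + A * b0) ^+ 2 + \sum_j (B * a j + A * b j) ^+ 2.
  by rewrite addr_ge0 ?sqr_ge0 // sumr_ge0 // => j _; rewrite sqr_ge0.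
move: key; have -> : \sum_j (B * a j + A * b j) ^+ 2 =
   B ^+ 2 * \sum_j a j ^+ 2 + A ^+ 2 * \sum_j b j ^+ 2 + 2 * A * B * \sum_j a j * b j.
  rewrite !mulr_sumr -!big_split /=; apply: eq_bigr => j _; ring.
have [A00|A00] := eqVneq A 0; last have [B00|B00] := eqVneq B 0.
- move: hA; rewrite A00 expr0n /= => /esym/eqP.
  rewrite paddr_eq0 ?sqr_ge0 ?sumr_ge0 // => [/andP[]|j _]; last exact: sqr_ge0.
  rewrite expf_eq0 /= => /eqP -> s0.
  have s0' j : a j = 0.
    move: s0; rewrite psumr_eq0; last by move=> i _; rewrite sqr_ge0.
    by move=> /allP /(_ j (mem_index_enum j)); rewrite /= expf_eq0 /= => /eqP.
  have -> : \sum_j a j * b j = 0 by apply: big1 => j _; rewrite s0' mul0r.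
  by rewrite !mul0r; lra.
- move: hB; rewrite B00 expr0n /= => /esym/eqP.
  rewrite paddr_eq0 ?sqr_ge0 ?sumr_ge0 // => [/andP[]|j _]; last exact: sqr_ge0.
  rewrite expf_eq0 /= => /eqP -> s0.
  have s0' j : b j = 0.
    move: s0; rewrite psumr_eq0; last by move=> i _; rewrite sqr_ge0.
    by move=> /allP /(_ j (mem_index_enum j)); rewrite /= expf_eq0 /= => /eqP.
  have -> : \sum_j a j * b j = 0 by apply: big1 => j _; rewrite s0' mulr0.
  by rewrite !mulr0; lra.
have AB : 0 < A * B by rewrite mulr_gt0 // lt0r ?A00 ?B00.
move: hA hB; set sa := \sum_j a j ^+ 2; set sb := \sum_j b j ^+ 2; set c := \sum_j _.
move=> hA hB key.
have -> : - (a0 * b0 + c) <= A * B = (0 <= (2 * (A * B)) * (A * B + (a0 * b0 + c))).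
  have AB2 : 0 < 2 * (A * B) by lra.
  by rewrite (pmulr_rge0 _ AB2) -[LHS]subr_ge0 opprK.
suff -> : 2 * (A * B) * (A * B + (a0 * b0 + c)) =
  (B * a0 + A * b0) ^+ 2 + (B ^+ 2 * sa + A ^+ 2 * sb + 2 * A * B * c) by [].
have -> : 2 * (A * B) * (A * B + (a0 * b0 + c)) = A ^+ 2 * B ^+ 2 + A ^+ 2 * B ^+ 2 + 2 * (A * B) * (a0 * b0 + c) by ring.
have e1 : A ^+ 2 * B ^+ 2 = B ^+ 2 * a0 ^+ 2 + B ^+ 2 * sa by rewrite hA; ring.
have e2 : A ^+ 2 * B ^+ 2 = A ^+ 2 * b0 ^+ 2 + A ^+ 2 * sb by rewrite hB; ring.
by rewrite {1}e1 e2; ring.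
Qed.

(* After moving q to height 1 above the origin, ch is the Minkowski product of
   (cosh, a) and (cosh, b) with a, b Euclidean vectors of norms sinh d(p,q), sinh d(q,w). *)
Lemma hdist_triangle q p w : in_Hd p -> in_Hd q -> in_Hd w ->
  hdist p w <= hdist p q + hdist q w.
Proof.
move=> pH qH wH; rewrite [hdist p w]hdistE //.
have p0 := ht_gt0 pH; have q0 := ht_gt0 qH; have w0 := ht_gt0 wH.
apply: arcosh_le; [exact: ch_ge1 | by rewrite addr_ge0 ?hdist_ge0 |].
rewrite coshD !cosh_hdist //.
pose a j := (hx p j - hx q j) / ht p; pose b j := (hx w j - hx q j) / ht w.
pose a0 := (dx2 p q + ht p ^+ 2 - ht q ^+ 2) / (2 * ht p * ht q).
pose b0 := (dx2 w q + ht w ^+ 2 - ht q ^+ 2) / (2 * ht w * ht q).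
have sa : \sum_j a j ^+ 2 = dx2 p q / ht p ^+ 2.
  by rewrite mulr_suml; apply: eq_bigr => j _; rewrite /a exprMn exprVn.
have sb : \sum_j b j ^+ 2 = dx2 w q / ht w ^+ 2.
  by rewrite mulr_suml; apply: eq_bigr => j _; rewrite /b exprMn exprVn.
have := @cauchy_schwarz a b a0 b0 (sinh (hdist p q)) (sinh (hdist q w)).
have -> : sinh (hdist p q) ^+ 2 = a0 ^+ 2 + \sum_j a j ^+ 2.
  by rewrite sinh2E cosh_hdist // sa /a0 /ch; field; rewrite !gt_eqF.
have -> : sinh (hdist q w) ^+ 2 = b0 ^+ 2 + \sum_j b j ^+ 2.
  by rewrite sinh2E cosh_hdist // chC sb /b0 /ch; field; rewrite !gt_eqF.
move=> /(_ erefl erefl (sinh_ge0 (hdist_ge0 pH qH)) (sinh_ge0 (hdist_ge0 qH wH))) cs.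
apply: le_trans (_ : ch p q * ch q w - (a0 * b0 + \sum_j a j * b j) <= _); last by lra.
rewrite le_eqVlt; apply/orP; left; apply/eqP; rewrite [ch q w]chC.
have -> : \sum_j a j * b j = (dx2 p q + dx2 w q - dx2 p w) / (2 * ht p * ht w).
  rewrite /dx2 -big_split -sumrB mulr_suml /=; apply: eq_bigr => j _; rewrite /a /b.
  by field; rewrite !gt_eqF.
by rewrite /ch /a0 /b0; field; rewrite !gt_eqF.
Qed.

Lemma hdist_vertical X y z : 0 < y -> 0 <= z ->
  hdist (mkH X y) (mkH X (y * expR z)) = z.
Proof.
move=> y0 z0; have e0 := expR_gt0 z; have ye : 0 < y * expR z by rewrite mulr_gt0.
have -> : hdist (mkH X y) (mkH X (y * expR z)) = arcosh (cosh z).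
  rewrite hdistE ?mkH_in // /ch !ht_mkH //; congr arcosh.
  have -> : dx2 (mkH X y) (mkH X (y * expR z)) = 0.
    by rewrite /dx2 big1 // => j _; rewrite !hx_mkH // subrr expr0n.
  by rewrite /cosh expRN; field; rewrite !gt_eqF.
have c1 := cosh_ge1 z; apply/eqP; rewrite eq_le arcosh_le //= le_arcosh //.
Qed.

End HalfSpace.

(** * Spanners from hierarchies of hubs *)

Section GraphDistance.
Variables (R : realType) (d : nat).
Notation T := (hpoint R d).
Implicit Types (E : seq (T * T)) (u v w : T) (a b : R).

Lemma graph_dist_le_refl E u a : 0 <= a -> graph_dist_le E u u a.
Proof. by move=> a0; exists [::]. Qed.

Lemma walk_length_cat u s t :
  walk_length u (s ++ t) = walk_length u s + walk_length (last u s) t :> R.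
Proof. by elim: s u => [|x s IHs] u /=; rewrite ?add0r // IHs addrA. Qed.

Lemma graph_dist_le_trans E u v w a b :
  graph_dist_le E u v a -> graph_dist_le E v w b -> graph_dist_le E u w (a + b).
Proof.
move=> [s [ps ls us]] [t [pt lt ut]]; exists (s ++ t); split.
- by rewrite cat_path ps ls.
- by rewrite last_cat ls.
- by rewrite walk_length_cat ls lerD.
Qed.

Lemma graph_dist_le_weak E u v a b : a <= b -> graph_dist_le E u v a -> graph_dist_le E u v b.
Proof. by move=> ab [s [ps ls us]]; exists s; split=> //; apply: le_trans ab. Qed.

Lemma graph_dist_le_sub E E' u v a :
  {subset E <= E'} -> graph_dist_le E u v a -> graph_dist_le E' u v a.
Proof.
move=> sE [s [ps ls us]]; exists s; split=> //.
by apply: sub_path ps => x y; rewrite /Defs.adjacent => /orP[/sE->|/sE->]; rewrite ?orbT.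
Qed.

Lemma graph_dist_le_edge E u v : (u, v) \in E -> graph_dist_le E u v (hdist u v).
Proof.
move=> uv; have h : Defs.adjacent E u v by apply/orP; left.
by exists [:: v]; rewrite /= h addr0.
Qed.

Lemma graph_dist_le_edgeC E u v : (u, v) \in E -> graph_dist_le E v u (hdist v u).
Proof.
move=> uv; have h : Defs.adjacent E v u by apply/orP; right.
by exists [:: u]; rewrite /= h addr0.
Qed.

(** Counting with multiplicity is additive when edge lists are concatenated, which [degree] is not;
    all bookkeeping below uses this count. *)
Lemma degree_le E (P : seq T) p : {in E, forall e, (e.1 \in P) && (e.2 \notin P)} -> p \in P ->
  (degree E p <= count (fun e => e.1 == p) E)%N.
Proof.
move=> EP pP; rewrite /degree.
have -> : [seq e <- E | e.2 == p] = [::].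
  apply/eqP; rewrite -(negbK (_ == _)) -has_filter; apply/hasPn => e /EP /andP[_ h].
  by apply: contra h => /eqP ->.
by rewrite cats0 (leq_trans (size_undup _)) // size_map size_filter.
Qed.

End GraphDistance.

(** * Clusters with two slots, merged at hubs *)

Section Hierarchy.
Variables (R : realType) (m : nat).
Notation T := (hpoint R m.+1).
Variable P : seq T.
Hypothesis PH : all (@in_Hd R m.+1) P.
Implicit Types (E : seq (T * T)) (u v z : T) (r l : R).

Let inP u : u \in P -> in_Hd u. Proof. by move/(allP PH). Qed.

(* The clusters are the fibers of c, which selects a representative. The points s1 z and s2 z
   are slots of the cluster of z: new edges at each of them keep all degrees at most 2. *)
Definition clustering E (c s1 s2 : T -> T) r : Prop :=
  [/\ forall u, u \in P -> c u \in P /\ c (c u) = c u,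
      forall u, u \in P -> [/\ s1 (c u) \in P, s2 (c u) \in P,
                               c (s1 (c u)) = c u & c (s2 (c u)) = c u],
      forall u, u \in P ->
        (count (fun e => e.1 == u) E + (s1 (c u) == u) + (s2 (c u) == u) <= 2)%N,
      forall u v, u \in P -> v \in P -> c u = c v ->
        graph_dist_le E u v r /\ hdist u v <= r &
      {in E, forall e, [&& e.1 \in P, e.2 \notin P & in_Hd e.2]}].

(** A singleton cluster carries both of its slots at its only point: degree 0 plus two slots meets
    the bound 2. *)
Lemma clustering_refl r : 0 <= r -> clustering [::] id id id r.
Proof.
move=> r0; split=> // [u uP|u v _ vP ->]; first by rewrite /= eqxx.
by split; [exact: graph_dist_le_refl | rewrite hdistxx // inP].
Qed.

Section Merge.
Variables (E : seq (T * T)) (c s1 s2 : T -> T) (r l : R) (g : T -> option T).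
Hypothesis cl : clustering E c s1 s2 r.
Hypotheses (r0 : 0 <= r) (l0 : 0 <= l).
Hypothesis gP : forall z q, z \in P -> g z = Some q -> [/\ in_Hd q, q \notin P & hdist z q <= l].

Let Z := undup (map c P).
Let grp z := [seq z' <- Z | g z' == g z].
(** A cluster alone at its hub gets no edge: it would spend a slot, and only a partner can supply
    the replacement. *)
Let grouped z := g z && (1 < size (grp z))%N.
Let lead z := if g z then head z (grp z) else z.
Let E' := E ++ [seq (s1 z, odflt z (g z)) | z <- Z & grouped z].
Let c' u := lead (c u).
(** The new edges spend the slot [s1] of every cluster in the group. The merged cluster inherits
    [s2] from its first two constituents, so it has two slots again. *)
Let s1' z := if grouped z then s2 (nth z (grp z) 0) else s1 z.
Let s2' z := if grouped z then s2 (nth z (grp z) 1) else s2 z.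

Let cP u : u \in P -> c u \in P. Proof. by case: cl => h _ _ _ _ /h[]. Qed.
Let ccE u : u \in P -> c (c u) = c u. Proof. by case: cl => h _ _ _ _ /h[]. Qed.
Let cZ u : u \in P -> c u \in Z. Proof. by move=> uP; rewrite mem_undup map_f. Qed.
Let ZP z : z \in Z -> z \in P /\ c z = z.
Proof. by rewrite mem_undup => /mapP[u uP ->]; rewrite cP // ccE. Qed.
Let s1P z : z \in Z -> s1 z \in P /\ c (s1 z) = z.
Proof. by case: cl => _ h _ _ _ /ZP[/h + e]; rewrite e => -[]. Qed.
Let s2P z : z \in Z -> s2 z \in P /\ c (s2 z) = z.
Proof. by case: cl => _ h _ _ _ /ZP[/h + e]; rewrite e => -[]. Qed.

Let grp_eq z z' : g z = g z' -> grp z = grp z'.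
Proof. by move=> e; rewrite /grp e. Qed.
Let mem_grp z : z \in Z -> z \in grp z.
Proof. by move=> zZ; rewrite mem_filter eqxx. Qed.
Let grpP z z' : z' \in grp z -> z' \in Z /\ g z' = g z.
Proof. by rewrite mem_filter => /andP[/eqP]. Qed.
Let lead_grp z : z \in Z -> lead z \in grp z.
Proof.
move=> zZ; rewrite /lead; case: ifP => _; last exact: mem_grp.
by have := mem_grp zZ; case: (grp z) => //= x s _; rewrite mem_head.
Qed.
Let lead_eq z z' : z \in Z -> g z -> g z = g z' -> lead z = lead z'.
Proof.
move=> zZ gz e; rewrite /lead -e gz (grp_eq e).
by have := mem_grp zZ; rewrite (grp_eq e); case: (grp z').
Qed.
Let leadK z : z \in Z -> lead (lead z) = lead z.
Proof.
move=> zZ; have [_ gl] := grpP (lead_grp zZ).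
case gz : (isSome (g z)); first by symmetry; apply: lead_eq.
by rewrite [lead z]/lead gz /lead gz.
Qed.
Let lead_ungrouped z : z \in Z -> ~~ grouped z -> lead z = z.
Proof.
move=> zZ; rewrite /grouped /lead; case: ifP => //= _; rewrite -leqNgt.
by have := mem_grp zZ; case: (grp z) => [|x [|]] //=; rewrite inE => /eqP.
Qed.
Let grouped_lead z : z \in Z -> grouped (lead z) = grouped z.
Proof. by move=> /lead_grp/grpP[_ e]; rewrite /grouped e (grp_eq e). Qed.

Let nth_grp z i : grouped z -> (i < 2)%N -> nth z (grp z) i \in grp z.
Proof. by case/andP=> _ h i2; apply: mem_nth; apply: leq_trans h. Qed.

Let merge_edge z q : z \in Z -> grouped z -> g z = Some q -> (s1 z, q) \in E'.
Proof.
move=> zZ gz e; rewrite mem_cat; apply/orP; right; apply/mapP; exists z; last by rewrite e.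
by rewrite mem_filter gz.
Qed.

Let grouped2 z z' : z \in Z -> z' \in Z -> z != z' -> g z -> g z = g z' -> grouped z.
Proof.
move=> zZ z'Z zz' gz e; rewrite /grouped gz /=.
have : {subset [:: z; z'] <= grp z}.
  by move=> x; rewrite !inE => /orP[]/eqP->; rewrite mem_filter ?zZ ?z'Z ?e eqxx.
by move/(uniq_leq_size _) => /=; apply; rewrite /= inE zz'.
Qed.

(** Walk from [u] to the slot of its cluster, through the hub to the other slot, then to [v]. The
    two ends cost at most r each, and each hub edge exceeds the distance from [u] or [v] to [q] by
    at most r. *)
Let merge_dist u v q : u \in P -> v \in P -> c u <> c v ->
  g (c u) = Some q -> g (c v) = Some q ->
  graph_dist_le E' u v (4 * r + hdist u q + hdist q v).
Proof.
move=> uP vP /eqP cuv gu gv; have [_ _ _ clD _] := cl.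
have uZ := cZ uP; have vZ := cZ vP.
have gu' : isSome (g (c u)) by rewrite gu.
have gr : grouped (c u) by apply: (grouped2 uZ vZ) => //; rewrite gu gv.
have gr' : grouped (c v).
  by apply: (grouped2 vZ uZ); rewrite 1?eq_sym // ?gv // gu.
have [qH _ _] := gP (cP uP) gu.
have [su cu] := s1P uZ; have [sv cv] := s1P vZ.
have [D1 H1] := clD _ _ uP su (esym cu); have [D2 H2] := clD _ _ sv vP cv.
have sE : {subset E <= E'} by move=> e eE; rewrite mem_cat eE.
have e1 := merge_edge uZ gr gu; have e2 := merge_edge vZ gr' gv.
have := graph_dist_le_trans (graph_dist_le_trans (graph_dist_le_sub sE D1) (graph_dist_le_edge e1))
  (graph_dist_le_trans (graph_dist_le_edgeC e2) (graph_dist_le_sub sE D2)).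
apply: graph_dist_le_weak.
have t1 := hdist_triangle (inP su) (inP uP) qH.
have t2 := hdist_triangle qH (inP vP) (inP sv).
by rewrite (hdistC (inP su) (inP uP)) in t1; rewrite (hdistC (inP vP) (inP sv)) in t2; lra.
Qed.

(** The new radius is 4 r + 2 (r + l): a point is within r of its representative, and that one
    within l of the hub. *)
Lemma clustering_merge : exists E' c' s1' s2',
  [/\ clustering E' c' s1' s2' (6 * r + 2 * l),
      {subset E <= E'} &
      forall u v q, u \in P -> v \in P -> c u <> c v -> g (c u) = Some q -> g (c v) = Some q ->
        graph_dist_le E' u v (4 * r + hdist u q + hdist q v)].
Proof.
have [_ _ clC clD clE] := cl.
have sE : {subset E <= E'} by move=> e eE; rewrite mem_cat eE.
have c's z z' : z \in Z -> g z -> z' \in grp (lead z) -> c' (s2 z') = lead z.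
  move=> zZ gz /grpP[z'Z gz']; rewrite /c' (s2P z'Z).2; apply/esym/lead_eq => //.
  by rewrite gz'; have [_ ->] := grpP (lead_grp zZ).
exists E', c', s1', s2'; split=> [|e eE|]; [|exact: sE|exact: merge_dist].
split.
- move=> u uP; have uZ := cZ uP; have [lZ _] := grpP (lead_grp uZ).
  by have [lP lc] := ZP lZ; rewrite /c' lc leadK.
- move=> u uP; have uZ := cZ uP; rewrite /c'; set z := c u in uZ *.
  have [lZ _] := grpP (lead_grp uZ).
  rewrite /s1' /s2'; case: ifPn => gr; last first.
    by have [? ->] := s1P lZ; have [? ->] := s2P lZ; rewrite leadK.
  have gz : isSome (g z) by move: gr; rewrite grouped_lead // => /andP[].
  have h1 := nth_grp gr (isT : (0 < 2)%N); have h2 := nth_grp gr (isT : (1 < 2)%N).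
  by split; [exact: (s2P (grpP h1).1).1 | exact: (s2P (grpP h2).1).1 | exact: c's | exact: c's].
- move=> u uP; have uZ := cZ uP; have := clC u uP; rewrite /c'; set z := c u in uZ *.
  rewrite count_cat count_map count_filter => clu.
  set k := count _ Z.
  (* Slots lie in their own cluster, so [s1 z' = u] forces [z'] to be the representative of [u]: at
     most one new edge starts at [u], and it uses up a slot there. *)
  have kle : (k <= (s1 z == u) && grouped z)%N.
    have [/andP[/eqP s1z gr]|ngr] := boolP ((s1 z == u) && grouped z).
      rewrite /k -size_filter; apply: (@uniq_leq_size _ _ [:: z]).
        by rewrite filter_uniq ?undup_uniq.
      move=> z'; rewrite mem_filter => /andP[/andP[/eqP /= s1z' _] z'Z].
      by have := (s1P z'Z).2; rewrite s1z' => <-; rewrite mem_head.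
    rewrite leqNgt -has_count; apply/hasPn => z' z'Z /=.
    apply: contra ngr => /andP[/eqP s1z' gr].
    by have <- : z' = z; [rewrite /z -s1z' (s1P z'Z).2 | rewrite s1z' eqxx].
  rewrite /s1' /s2' grouped_lead //; case: ifPn => gr; last first.
    by rewrite lead_ungrouped //; move: kle; rewrite (negbTE gr) andbF; lia.
  have gr' : grouped (lead z) by rewrite grouped_lead.
  have h1 := nth_grp gr' (isT : (0 < 2)%N); have h2 := nth_grp gr' (isT : (1 < 2)%N).
  set z1 := nth _ _ 0 in h1 *; set z2 := nth _ _ 1 in h2 *.
  have z12 : z1 != z2.
    by case/andP: gr' => _ sz; rewrite nth_uniq ?filter_uniq ?undup_uniq // ltnW.
  (* A new slot at [u] must be the old slot [s2] of the cluster of [u], and at most one of the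
     distinct [z1], [z2] represents that cluster. *)
  have e1 : (s2 z1 == u) = (z1 == z) && (s2 z == u).
    have [->//|nz] := eqVneq z1 z.
    by apply: contraNF nz => /eqP e; rewrite /z -e (s2P (grpP h1).1).2.
  have e2 : (s2 z2 == u) = (z2 == z) && (s2 z == u).
    have [->//|nz] := eqVneq z2 z.
    by apply: contraNF nz => /eqP e; rewrite /z -e (s2P (grpP h2).1).2.
  move: clu kle; rewrite e1 e2 gr andbT.
  have : ~~ ((z1 == z) && (z2 == z)) by apply: contra z12 => /andP[/eqP-> /eqP->].
  move: (z1 == z) (z2 == z) (s1 z == u) (s2 z == u) k (count _ E); clear.
  by move=> [] [] [] [] k n //=; lia.
- move=> u v uP vP cuv; have uZ := cZ uP; have vZ := cZ vP.
  have [e|ne] := eqVneq (c u) (c v).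
    have [D H] := clD u v uP vP e.
    by split; [apply: graph_dist_le_weak (graph_dist_le_sub sE D)|]; move: r0 l0 H; lra.
  have gz : isSome (g (c u)).
    case gu : (isSome (g (c u))) => //; move: cuv; rewrite /c'.
    have -> : lead (c u) = c u by rewrite /lead gu.
    move=> e; have := (grpP (lead_grp vZ)).2; rewrite -e => e'.
    by move: ne; rewrite e {1}/lead -e' gu eqxx.
  have ge : g (c u) = g (c v).
    by rewrite -(grpP (lead_grp uZ)).2 -(grpP (lead_grp vZ)).2 -/(c' u) -/(c' v) cuv.
  case gq : (g (c u)) gz => [q|//] _; move: (ge); rewrite gq => /esym gq'.
  have [qH _ uq] := gP (cP uP) gq; have [_ _ vq] := gP (cP vP) gq'.
  have uq' : hdist u q <= r + l.
    apply: le_trans (hdist_triangle (inP uP) (inP (cP uP)) qH) _.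
    by have [_ h] := clD _ _ uP (cP uP) (esym (ccE uP)); apply: lerD.
  have vq' : hdist q v <= r + l.
    rewrite (hdistC qH (inP vP)).
    apply: le_trans (hdist_triangle (inP vP) (inP (cP vP)) qH) _.
    by have [_ h] := clD _ _ vP (cP vP) (esym (ccE vP)); apply: lerD.
  split; last by apply: le_trans (hdist_triangle (inP uP) qH (inP vP)) _; move: r0 l0 uq' vq'; lra.
  apply: graph_dist_le_weak (merge_dist uP vP (elimN eqP ne) gq gq'); move: r0 l0 uq' vq'; lra.
- move=> e; rewrite mem_cat => /orP[/clE //|/mapP[z + ->]].
  rewrite mem_filter => /andP[/andP[gz _] zZ] /=.
  case gz' : (g z) gz => [q|] // _; have [zP _] := ZP zZ.
  by have [-> -> _] := gP zP gz'; rewrite (s1P zZ).1.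
Qed.

End Merge.
End Hierarchy.

(** The condition on [B] makes 6 r + 2 l, for r = theta L and l = 5 L, at most the radius theta B L
    required at the next scale. A pair already in one cluster is served by the cluster radius;
    otherwise both representatives are close enough to the endpoints to be sent to the same hub. *)
Lemma hierarchy_exists (R : realType) (m : nat) (P : seq (hpoint R m.+1))
    (g : nat -> hpoint R m.+1 -> option (hpoint R m.+1)) (theta B L0 : R) (N : nat) :
  all (@in_Hd R m.+1) P -> 0 <= theta -> 0 <= L0 -> 0 <= B -> 6 * theta + 10 <= B * theta ->
  (forall n z q, z \in P -> g n z = Some q ->
     [/\ in_Hd q, q \notin P & hdist z q <= 5 * (L0 * B ^+ n)]) ->
  exists E c s1 s2,
    clustering P E c s1 s2 (theta * (L0 * B ^+ N)) /\
    forall n u v q, (n < N)%N -> u \in P -> v \in P ->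
      (forall z, z \in P -> hdist z u <= theta * (L0 * B ^+ n) -> g n z = Some q) ->
      (forall z, z \in P -> hdist z v <= theta * (L0 * B ^+ n) -> g n z = Some q) ->
      graph_dist_le E u v (4 * (theta * (L0 * B ^+ n)) + hdist u q + hdist q v).
Proof.
move=> PH t0 L00 B0 hB gP.
have Ln n : 0 <= L0 * B ^+ n by rewrite mulr_ge0 ?exprn_ge0.
elim: N => [|N [E [c [s1 [s2 [cl good]]]]]].
  exists [::], id, id, id; split=> //.
  by apply: clustering_refl => //; rewrite mulr_ge0.
have r0 : 0 <= theta * (L0 * B ^+ N) by rewrite mulr_ge0.
have l0 : 0 <= 5 * (L0 * B ^+ N) by rewrite mulr_ge0.
have [E' [c' [s1' [s2' [cl' sE new]]]]] := clustering_merge PH cl r0 l0 (gP N).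
exists E', c', s1', s2'; split.
  case: cl' => h1 h2 h3 h4 h5; split=> // u v uP vP /(h4 u v uP vP)[D H].
  have le : 6 * (theta * (L0 * B ^+ N)) + 2 * (5 * (L0 * B ^+ N)) <= theta * (L0 * B ^+ N.+1).
    by rewrite exprS; have := Ln N; nra.
  by split; [apply: graph_dist_le_weak D | apply: le_trans le].
move=> n u v q; rewrite ltnS leq_eqVlt => /orP[/eqP ->|nN] uP vP gu gv; last first.
  by apply: graph_dist_le_sub sE _; apply: good.
have [cP _ _ cD _] := cl.
have [cuP cuu] := cP u uP; have [cvP cvv] := cP v vP.
have [_ du] := cD _ _ cuP uP cuu; have [_ dv] := cD _ _ cvP vP cvv.
have [e|ne] := eqVneq (c u) (c v); last first.
  by apply: new => //; [apply/eqP | apply: gu | apply: gv].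
have [D H] := cD _ _ uP vP e.
have uH := allP PH _ uP; have vH := allP PH _ vP.
have [qH _ _] := gP N _ _ cuP (gu _ cuP du).
apply: graph_dist_le_weak (graph_dist_le_sub sE D).
have := hdist_ge0 uH qH; have := hdist_ge0 qH vH; move: r0.
by set x := theta * _; lra.
Qed.

(** * From robust hubs at every scale to a spanner *)

Section Assembly.
Variables (R : realType) (m : nat).
Notation T := (hpoint R m.+1).

(** Steiner points must avoid [P]; a vertical ray from [q] offers infinitely many candidates within
    [eta], and [P] is finite. *)
Lemma perturb (P : seq T) (q : T) (eta : R) : in_Hd q -> 0 < eta ->
  exists q', [/\ in_Hd q', q' \notin P & hdist q q' <= eta].
Proof.
move=> qH e0; have q0 := ht_gt0 qH.
pose f (n : nat) := mkH (hx q) (ht q * expR (eta / n.+1%:R)).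
have f0 n : 0 < ht q * expR (eta / n.+1%:R) by rewrite mulr_gt0 ?expR_gt0.
have finj : injective f.
  move=> i j /(congr1 (@ht R m)); rewrite !ht_mkH // => /(mulfI (lt0r_neq0 q0)) /expR_inj.
  move=> /(mulfI (lt0r_neq0 e0)) /invr_inj /eqP; rewrite eqr_nat => /eqP []; done.
have [n nP] : exists n, f n \notin P.
  apply: contrapT => h.
  have : (size (map f (iota 0 (size P).+1)) <= size P)%N.
    apply: uniq_leq_size; first by rewrite map_inj_uniq ?iota_uniq.
    move=> x /mapP[n _ ->]; apply: contrapT => /negP nP; apply: h; by exists n.
  by rewrite size_map size_iota ltnn.
exists (f n); split=> //; first exact: mkH_in.
have qE : q = mkH (hx q) (ht q).
  by apply: in_Hd_eq; rewrite ?mkH_in ?ht_mkH // => j; rewrite hx_mkH.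
have en : 0 <= eta / n.+1%:R by rewrite divr_ge0 // ltW.
rewrite {1}qE (hdist_vertical (hx q) q0 en).
have n0 : 0 < n.+1%:R :> R by [].
by rewrite (ler_pdivrMr _ _ n0); apply: ler_peMr; [exact: ltW | rewrite ler1n].
Qed.

Lemma seq_pos_lower_bound (s : seq R) :
  exists2 a : R, 0 < a & forall x, x \in s -> 0 < x -> a <= x.
Proof.
elim: s => [|y s [a a0 ha]]; first by exists 1.
have [y0|y0] := ltP 0 y; last first.
  exists a => // x; rewrite inE => /orP[/eqP->|/ha//]; lra.
exists (Num.min a y); first by rewrite lt_min a0.
by move=> x; rewrite inE ge_min => /orP[/eqP-> _|/ha h /h ->//]; rewrite lexx orbT.
Qed.

Lemma seq_upper_bound (s : seq R) : exists b, forall x, x \in s -> x <= b.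
Proof.
elim: s => [|y s [b hb]]; first by exists 0.
by exists (Num.max b y) => x; rewrite inE le_max => /orP[/eqP->|/hb->//]; rewrite lexx orbT.
Qed.

Lemma dyadic_scale (a x : R) : 0 < a -> a <= x -> exists i, a * 2 ^+ i <= x < a * 2 ^+ i.+1.
Proof.
move=> a0 ax.
have ex : exists n, x < a * 2 ^+ n.
  exists (Num.truncn (x / a)).+1.
  have xa : 0 <= x / a by rewrite divr_ge0 ?ltW //; lra.
  have /andP[_ h] := truncn_itv xa.
  rewrite mulrC -ltr_pdivrMr //; apply: lt_trans h _.
  by rewrite -natrX ltr_nat ltn_expl.
case: (ex_minnP ex) => [[|i]]; first by rewrite expr0 mulr1; lra.
move=> hi imin; exists i; rewrite hi andbT leNgt; apply/negP => /imin; by rewrite ltnn.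
Qed.

(** The excess at scale L is eps L / 2 from the hub, 4 theta L from the clusters and 2 theta L from
    moving the hub off [P]; this is why 12 theta <= eps. There are [J] residues and [K] names, hence
    [J * K] hierarchies of degree at most 2. *)
Lemma spanner_of_hubs (eps theta : R) (P : seq T) (K J : nat) (G : R -> nat -> T -> T) :
  all (@in_Hd R m.+1) P -> 0 < theta -> 12 * theta <= eps -> eps <= 1 -> (0 < J)%N ->
  6 * theta + 10 <= 2 ^+ J * theta ->
  (forall L k z, in_Hd (G L k z)) ->
  (forall L u v, 0 < L -> in_Hd u -> in_Hd v -> L <= hdist u v < 2 * L ->
     exists k q, [/\ (k < K)%N, hdist u q + hdist q v <= hdist u v + eps / 2 * L &
       forall z, in_Hd z -> hdist z u <= theta * L \/ hdist z v <= theta * L -> G L k z = q]) ->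
  exists Q E, bipartite_steiner_spanner (1 + eps) P Q E /\
    forall p, p \in P -> (degree E p <= 2 * J * K)%N.
Proof.
move=> PH t0 teps eps1 J0 hB GH Good.
have [a a0 amin] := seq_pos_lower_bound [seq hdist u v | u <- P, v <- P].
have [b bmax] := seq_upper_bound [seq hdist u v | u <- P, v <- P].
pose N := (Num.truncn (b / a)).+2.
have bN : b < a * 2 ^+ N.
  have [b0|b0] := ltP b 0; first by apply: lt_le_trans b0 _; rewrite mulr_ge0 ?exprn_ge0 // ltW.
  have ba : 0 <= b / a by rewrite divr_ge0 // ltW.
  have /andP[_ h] := truncn_itv ba.
  rewrite mulrC -ltr_pdivrMr //; apply: lt_trans h _.
  by rewrite -natrX ltr_nat; apply: leq_ltn_trans (leqnSn _) _; rewrite ltn_expl.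
(* The shift is a function of the hub and the size alone, so a hub found from two different points
   is moved to one and the same place. *)
have /choice[pert pertP] : forall x : T * R, exists q', in_Hd x.1 -> 0 < x.2 ->
    [/\ in_Hd q', q' \notin P & hdist x.1 q' <= x.2].
  move=> [q eta] /=; have [qH|nqH] := boolP (in_Hd q); last by exists q.
  have [e0|e0] := ltP 0 eta; last by exists q.
  by have [q' h] := perturb P qH e0; exists q'.
pose sc r n : R := a * 2 ^+ r * (2 ^+ J) ^+ n.
have sc0 r n : 0 < sc r n by rewrite !mulr_gt0 ?exprn_gt0.
pose hub L k z := pert (G L k z, theta * L).
(* [G] answers for every name, possibly with a very distant hub; the cutoff keeps the cluster radii
   bounded. It loses no useful hub, since those are within 2 L + eps L / 2 + 2 theta L <= 5 L. *)
pose g (x : nat * nat) n z := let q := hub (sc x.1 n) x.2 z in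
  if hdist z q <= 5 * sc x.1 n then Some q else None.
have hubP r n k z : [/\ in_Hd (hub (sc r n) k z), hub (sc r n) k z \notin P &
   hdist (G (sc r n) k z) (hub (sc r n) k z) <= theta * sc r n].
  by apply: (pertP (G _ k z, _)) => //=; rewrite mulr_gt0.
have /choice[tree treeP] : forall x : nat * nat, exists E,
   (exists c s1 s2 r, clustering P E c s1 s2 r) /\
   forall n u v q, (n < N)%N -> u \in P -> v \in P ->
      (forall z, z \in P -> hdist z u <= theta * sc x.1 n -> g x n z = Some q) ->
      (forall z, z \in P -> hdist z v <= theta * sc x.1 n -> g x n z = Some q) ->
      graph_dist_le E u v (4 * (theta * sc x.1 n) + hdist u q + hdist q v).
  move=> x; have A : 0 <= a * 2 ^+ x.1 by rewrite mulr_ge0 ?exprn_ge0 // ltW.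
  have B : 0 <= 2 ^+ J :> R by rewrite exprn_ge0.
  have gx n z q : z \in P -> g x n z = Some q ->
      [/\ in_Hd q, q \notin P & hdist z q <= 5 * (a * 2 ^+ x.1 * (2 ^+ J) ^+ n)].
    move=> zP; rewrite /g; case: ifP => // h [<-]; split=> //.
    + by have [] := hubP x.1 n x.2 z.
    + by have [] := hubP x.1 n x.2 z.
  have [E [c [s1 [s2 [cl good]]]]] := hierarchy_exists N PH (ltW t0) A B hB gx.
  by exists E; split=> //; exists c, s1, s2, (theta * sc x.1 N).
pose idx := [seq (r, k) | r <- iota 0 J, k <- iota 0 K].
pose E := flatten [seq tree x | x <- idx].
have EP : {in E, forall e, [&& e.1 \in P, e.2 \notin P & in_Hd e.2]}.
  move=> e /flatten_mapP[x _ eE].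
  by have [[c [s1 [s2 [r [_ _ _ _ h]]]]] _] := treeP x; apply: h.
exists [seq e.2 | e <- E], E; split; last first.
  move=> p pP; apply: leq_trans (degree_le _ pP) _.
    by move=> e /EP/and3P[-> -> _].
  rewrite /E count_flatten -map_comp.
  have -> : (2 * J * K)%N = (2 * size idx)%N by rewrite size_allpairs !size_iota mulnA.
  elim: (idx) => //= x s IHs; rewrite mulnS leq_add //.
  have [[c [s1 [s2 [r [_ _ h _ _]]]]] _] := treeP x.
  by have := h p pP; rewrite -addnA; apply: leq_trans; rewrite leq_addr.
split.
- by apply/allP => q /mapP[e /EP/and3P[_ _ h] ->].
- by apply/allP => q /mapP[e /EP/and3P[_ h _] ->].
- by apply/allP => e eE; case/and3P: (EP e eE) => -> _ _; rewrite map_f.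
move=> u v uP vP; have uH := allP PH _ uP; have vH := allP PH _ vP.
have [->|uv] := eqVneq u v.
  by apply: graph_dist_le_refl; rewrite hdistxx // mulr0.
have d0 : 0 < hdist u v.
  rewrite lt0r hdist_ge0 // andbT; apply: contra uv => /eqP h.
  by apply/eqP/hdist_eq0.
have dP : hdist u v \in [seq hdist u v | u <- P, v <- P] by apply/allpairsP; exists (u, v).
have [i /andP[il iu]] := dyadic_scale a0 (amin _ dP d0).
have iN : (i < N)%N.
  have : a * 2 ^+ i < a * 2 ^+ N by apply: le_lt_trans il _; apply: le_lt_trans (bmax _ dP) bN.
  by rewrite ltr_pM2l // -!natrX ltr_nat ltn_exp2l.
(* The scale index splits as [n * J + r]: the residue selects the hierarchy, the quotient the level
   inside it. *)
pose r := (i %% J)%N; pose n := (i %/ J)%N.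
have scE : sc r n = a * 2 ^+ i.
  by rewrite /sc -mulrA -exprM -exprD; congr (_ * _ ^+ _); rewrite addnC mulnC -divn_eq.
have nN : (n < N)%N by apply: leq_ltn_trans iN; apply: leq_div.
have L0 := sc0 r n; set L := sc r n in L0.
have Ld : L <= hdist u v < 2 * L.
  by rewrite /L scE il /=; move: iu; rewrite exprS; lra.
have [k [q0 [kK ex rob]]] := Good L u v L0 uH vH Ld.
have q0E : G L k u = q0 by apply: rob => //; left; rewrite hdistxx // mulr_ge0 // ltW.
have q0H : in_Hd q0 by rewrite -q0E.
pose q := hub L k u.
have [qH _ qq0] := hubP r n k u; rewrite -/L q0E -/q in qH qq0.
have t1 := hdist_triangle uH q0H qH; have t2 := hdist_triangle qH q0H vH.
rewrite (hdistC qH q0H) in t2.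
have p1 := hdist_ge0 uH q0H; have p2 := hdist_ge0 q0H vH.
case/andP: Ld => Ld1 Ld2.
have xk : (r, k) \in idx by apply/allpairsP; exists (r, k); rewrite !mem_iota /= ltn_mod J0 kK.
have sub : {subset tree (r, k) <= E} by move=> e eE; apply/flatten_mapP; exists (r, k).
apply: graph_dist_le_sub sub _.
have [_ good] := treeP (r, k).
have near w z : in_Hd w -> z \in P -> hdist w q0 <= hdist u v + eps / 2 * L ->
    hdist z w <= theta * L -> G L k z = q0 -> g (r, k) n z = Some q.
  move=> wH zP wq zw Gz; have zH := allP PH _ zP.
  have hE : hub L k z = q by rewrite /hub Gz /q /hub q0E.
  rewrite /g /= -/L hE ifT //.
  apply: le_trans (hdist_triangle zH q0H qH) _.
  by have := hdist_triangle zH wH q0H; nra.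
apply: (@graph_dist_le_weak _ _ _ _ _ (4 * (theta * L) + hdist u q + hdist q v)); first nra.
apply: good => // z zP zu.
- by apply: (near u) => //; [lra | apply: rob => //; [exact: (allP PH) | left]].
- apply: (near v) => //; [rewrite hdistC //; lra | apply: rob => //; [exact: (allP PH) | by right]].
Qed.

End Assembly.

(** * Detours near a geodesic *)

Lemma sqr_mono (R : realDomainType) (x y : R) : 0 <= x -> x <= y -> x ^+ 2 <= y ^+ 2.
Proof. by move=> x0 xy; rewrite ler_sqr // nnegrE (le_trans x0). Qed.

Lemma floor_grid (R : realType) (s x : R) : 0 < s ->
  0 <= x - s * (Num.floor (x / s))%:~R < s.
Proof.
move=> s0; have /andP[] := floor_itv (x / s); rewrite ler_pdivlMr // ltr_pdivrMr // intrD.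
by move: (_%:~R) => a h1 h2; apply/andP; split; lra.
Qed.

(** One coordinate at a time: [a] and [b] belong to the endpoints, and [q] is the result of rounding
    down the chord point at fraction [f]. *)
Lemma near_chord_point (R : realType) (a b f q E r : R) : 0 <= f <= 1 -> `|a - b| <= E ->
  0 <= (1 - f) * a + f * b - q <= r -> `|a - q| <= E + r /\ `|b - q| <= E + r.
Proof.
move=> /andP[f0 f1]; rewrite !ler_norml => /andP[b1 b2] /andP[a1 a2].
have [fd1 fd2] : f * (a - b) <= E /\ - E <= f * (a - b) by split; nra.
have [fd3 fd4] : (1 - f) * (a - b) <= E /\ - E <= (1 - f) * (a - b) by split; nra.
by split; apply/andP; split; lra.
Qed.

Lemma four_lt_eight (R : realType) (Y : R) : 0 < Y -> 2 * Y + 2 * Y < 16%:R / 2 * Y.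
Proof. by lra. Qed.

(** The log-height [s] of the hub stays within 3 L of the log-height of any point near an endpoint;
    this fixes the length of the window in [hub_family_large]. *)
Lemma large_window (R : realType) (l1 l2 lw lz lc l n s h L d : R) :
  l = n + l1 + l2 + lc -> 0 <= n -> n <= 1 -> 0 <= lc -> lc <= d -> d < 2 * L ->
  `|l1 - l2| <= d -> lw = l1 \/ lw = l2 -> `|lz - lw| <= h -> 0 < h -> h <= L / 16 -> 40 <= L ->
  l / 2 + h <= s -> s <= l / 2 + 2 * h -> `|lz - s| <= 3 * L.
Proof.
by rewrite !ler_norml => -> ? ? ? ? ? /andP[? ?] [] -> /andP[? ?] *; apply/andP; split; lra.
Qed.

Section Detour.
Variables (R : realType) (m : nat).
Notation T := (hpoint R m.+1).

(* The point of horizontal coordinates (1 - f) hx u + f hx v on the geodesic from u to v has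
   height ym; as a vector of the hyperboloid it is s u + t v. *)
Lemma detour_le (u v q : T) (f ym W : R) : in_Hd u -> in_Hd v -> in_Hd q ->
  0 < f < 1 -> 0 < ym -> 0 < W ->
  ym ^+ 2 = (1 - f) * ht u ^+ 2 + f * ht v ^+ 2 + f * (1 - f) * dx2 u v ->
  W ^+ 2 <= (dx2 u v + (ht u - ht v) ^+ 2) * (dx2 u v + (ht u + ht v) ^+ 2) ->
  hdist u q + hdist q v <= hdist u v +
    ym * (\sum_j ((1 - f) * hx u j + f * hx v j - hx q j) ^+ 2 + (ym - ht q) ^+ 2)
      / (ht q * (f * (1 - f)) * W).
Proof.
move=> uH vH qH /andP[f0 f1] y0 W0 yE WE.
have -> : \sum_j ((1 - f) * hx u j + f * hx v j - hx q j) ^+ 2 =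
   (1 - f) * dx2 u q + f * dx2 v q - f * (1 - f) * dx2 u v.
  rewrite /dx2 !mulr_sumr -big_split -sumrB /=; apply: eq_bigr => j _; ring.
have f1' : 0 < 1 - f by lra.
have y1 := ht_gt0 uH; have y2 := ht_gt0 vH; have yq := ht_gt0 qH.
rewrite (hdistC qH vH).
have U1 := ch_ge1 uH qH; have V1 := ch_ge1 vH qH; have c1 := ch_ge1 uH vH.
pose s := (1 - f) * ht u / ym; pose t := f * ht v / ym.
have s0 : 0 < s by rewrite /s divr_gt0 ?mulr_gt0.
have t0 : 0 < t by rewrite /t divr_gt0 ?mulr_gt0.
set D := dx2 u v in yE WE *; set Du := dx2 u q; set Dv := dx2 v q.
have ymn : ym != 0 by rewrite gt_eqF.
have nrm : s ^+ 2 + t ^+ 2 + 2 * s * t * ch u v = 1.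
  have -> : s ^+ 2 + t ^+ 2 + 2 * s * t * ch u v =
     ((1 - f) * ht u ^+ 2 + f * ht v ^+ 2 + f * (1 - f) * D) / ym ^+ 2.
    by rewrite /s /t /ch -/D; field; rewrite !gt_eqF.
  by rewrite -yE divff // expf_neq0.
(* By bilinearity the left side is [ch] between the geodesic point s u + t v and [q], minus 1. *)
have Hq : s * ch u q + t * ch v q - 1 =
    ((1 - f) * Du + f * Dv - f * (1 - f) * D + (ym - ht q) ^+ 2) / (2 * ym * ht q).
  have -> : (ym - ht q) ^+ 2 = ym ^+ 2 + ht q ^+ 2 - 2 * ym * ht q by ring.
  by rewrite yE /s /t /ch -/Du -/Dv; field; rewrite !gt_eqF.
set c := ch u v in nrm c1 *; set U := ch u q in U1 Hq *; set V := ch v q in V1 Hq *.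
pose S := sinh (hdist u v).
have S0 : 0 <= S by apply/sinh_ge0/hdist_ge0.
have S2 : S ^+ 2 = c ^+ 2 - 1 by rewrite /S sinh2E cosh_hdist.
have SW : W / (2 * ht u * ht v) <= S.
  rewrite -(@ler_pXn2r _ 2) ?nnegrE //; last by rewrite divr_ge0 ?mulr_ge0 ?ltW.
  have -> : S ^+ 2 = ((D + (ht u - ht v) ^+ 2) * (D + (ht u + ht v) ^+ 2)) / (2 * ht u * ht v) ^+ 2.
    by rewrite S2 /c /ch -/D; field; rewrite !gt_eqF.
  by rewrite exprMn exprVn ler_wpM2r ?invr_ge0 ?sqr_ge0.
have Sp : 0 < S by apply: lt_le_trans SW; rewrite divr_gt0 ?mulr_gt0.
have c0 : 0 <= c by apply: le_trans c1.
have s0' := ltW s0; have t0' := ltW t0.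
(* [A] and [B] are cosh of the distances from the geodesic point to [u] and [v]; the corresponding
   sinh are [t * S] and [s * S]. *)
pose A := s + t * c; pose B := t + s * c.
have A2 : A ^+ 2 - 1 = (t * S) ^+ 2.
  by rewrite exprMn S2 -[X in _ - X = _]nrm /A; ring.
have B2 : B ^+ 2 - 1 = (s * S) ^+ 2.
  by rewrite exprMn S2 -[X in _ - X = _]nrm /B; ring.
have A1 : 1 <= A.
  have A0 : 0 <= A by exact: addr_ge0 s0' (mulr_ge0 t0' c0).
  by rewrite -(@ler_pXn2r _ 2) ?nnegrE // expr1n -subr_ge0 A2 sqr_ge0.
have B1 : 1 <= B.
  have B0 : 0 <= B by exact: addr_ge0 t0' (mulr_ge0 s0' c0).
  by rewrite -(@ler_pXn2r _ 2) ?nnegrE // expr1n -subr_ge0 B2 sqr_ge0.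
have tS : 0 < t * S by exact: mulr_gt0 t0 Sp.
have sS : 0 < s * S by exact: mulr_gt0 s0 Sp.
have shA : sinh (arcosh A) = t * S.
  by rewrite sinh_arcosh // A2 sqrtr_sqr ger0_norm // ltW.
have shB : sinh (arcosh B) = s * S.
  by rewrite sinh_arcosh // B2 sqrtr_sqr ger0_norm // ltW.
have AB : arcosh A + arcosh B <= hdist u v.
  rewrite hdistE //; apply: le_arcosh => //.
  rewrite coshD !cosh_arcosh // shA shB.
  have -> : A * B + t * S * (s * S) = A * B + s * t * S ^+ 2 by ring.
  rewrite S2 -/c; have -> : A * B + s * t * (c ^+ 2 - 1) = c * (s ^+ 2 + t ^+ 2 + 2 * s * t * c).
    by rewrite /A /B; ring.
  by rewrite nrm mulr1.
have hu : hdist u q <= arcosh A + (U - A) / (t * S).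
  rewrite hdistE //; apply: arcosh_tangent; [exact: U1 | by rewrite shA | exact: arcosh_ge0 |].
  by rewrite shA cosh_arcosh // divfK ?gt_eqF.
have hv : hdist v q <= arcosh B + (V - B) / (s * S).
  rewrite hdistE //; apply: arcosh_tangent; [exact: V1 | by rewrite shB | exact: arcosh_ge0 |].
  by rewrite shB cosh_arcosh // divfK ?gt_eqF.
(* Because s A + t B = 1, the two tangent errors combine into (cosh of the distance from the
   geodesic point to [q], minus 1) / (s t S): the first-order terms are gone. *)
have sum : (U - A) / (t * S) + (V - B) / (s * S) = (s * U + t * V - 1) / (s * t * S).
  have -> : s * U + t * V - 1 = s * U + t * V - (s ^+ 2 + t ^+ 2 + 2 * s * t * c) by rewrite nrm.
  by rewrite /A /B; field; rewrite !gt_eqF.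
apply: (@le_trans _ _ (hdist u v + (s * U + t * V - 1) / (s * t * S))); first lra.
rewrite lerD2l Hq.
set M := (1 - f) * Du + f * Dv - _ + _.
have M0 : 0 <= M.
  have -> : M = \sum_j ((1 - f) * hx u j + f * hx v j - hx q j) ^+ 2 + (ym - ht q) ^+ 2.
    rewrite /M /Du /Dv /D /dx2 !mulr_sumr -big_split -sumrB /=; congr (_ + _).
    by apply: eq_bigr => j _; ring.
  by rewrite addr_ge0 ?sqr_ge0 // sumr_ge0 // => j _; rewrite sqr_ge0.
have -> : ym * M / (ht q * (f * (1 - f)) * W) =
   M / (2 * ym * ht q) / (s * t * (W / (2 * ht u * ht v))).
  by rewrite /s /t; field; rewrite !gt_eqF.
apply: ler_wpM2l; first by rewrite divr_ge0 // ?mulr_ge0 ?ltW.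
have st0 : 0 < s * t by exact: mulr_gt0 s0 t0.
have W' : 0 < W / (2 * ht u * ht v) by rewrite divr_gt0 ?mulr_gt0.
have p1 : s * t * S \is Num.pos by rewrite posrE; exact: mulr_gt0.
have p2 : s * t * (W / (2 * ht u * ht v)) \is Num.pos by rewrite posrE; exact: mulr_gt0.
by rewrite (lef_pV2 p1 p2) (ler_pM2l st0).
Qed.

(* The integer congruent to k modulo N in the window of length N around x: the residue of an
   integer names it for all x at distance less than N / 2. *)
Definition grid_pick (N k : nat) (x : R) : int :=
  k%:Z + N%:Z * Num.floor ((x - k%:R) / N%:R + 2^-1).

Lemma grid_pickP N (n : int) : (0 < N)%N ->
  exists k : 'I_N, forall x : R, `|x - n%:~R| < N%:R / 2 -> grid_pick N k x = n.
Proof.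
move=> N0; have Nn0 : N%:Z != 0 by lia.
have k0 := modz_ge0 n Nn0; have kN : (`|(n %% N%:Z)%Z| < N)%N.
  by have := @ltz_pmod n N%:Z; lia.
exists (Ordinal kN) => x /=; have kE : `|(n %% N%:Z)%Z|%:Z = (n %% N%:Z)%Z by lia.
have nE := divz_eq n N%:Z; set j := (n %/ N%:Z)%Z in nE.
rewrite /grid_pick kE -[_%:R as X in (x - X)]/(`|(n %% N%:Z)%Z|%:Z%:~R) kE.
have NR : 0 < N%:R :> R by rewrite ltr0n.
have nR : n%:~R = j%:~R * N%:R + (n %% N%:Z)%Z%:~R :> R.
  by rewrite {1}nE rmorphD rmorphM.
rewrite nR ltr_norml => /andP[h1 h2].
have -> : Num.floor ((x - (n %% N%:Z)%Z%:~R) / N%:R + 2^-1) = j.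
  apply: floor_def.
  have -> : (x - (n %% N%:Z)%Z%:~R) / N%:R + 2^-1 = (x - (n %% N%:Z)%Z%:~R + N%:R / 2) / N%:R.
    by field; rewrite gt_eqF.
  by rewrite ler_pdivlMr // ltr_pdivrMr // intrD; lra.
by rewrite mulrC addrC -nE.
Qed.

End Detour.

(** * Hubs *)

Section HubBasics.
Variables (R : realType) (m : nat).
Notation T := (hpoint R m.+1).
Implicit Types u v p q : T.

Lemma norm_le_sqr (x a : R) : 0 <= a -> x ^+ 2 <= a ^+ 2 -> `|x| <= a.
Proof. by move=> a0 h; rewrite -(@ler_pXn2r _ 2) ?nnegrE // real_normK // num_real. Qed.

Lemma ch_sum u v : in_Hd u -> in_Hd v ->
  dx2 u v + ht u ^+ 2 + ht v ^+ 2 = 2 * ht u * ht v * ch u v.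
Proof.
move=> /ht_gt0 u0 /ht_gt0 v0; rewrite /ch; field; by rewrite !gt_eqF.
Qed.

Lemma dx2E u v : in_Hd u -> in_Hd v ->
  dx2 u v + (ht u - ht v) ^+ 2 = 2 * ht u * ht v * (cosh (hdist u v) - 1).
Proof.
move=> uH vH; rewrite cosh_hdist //; have := ch_sum uH vH; rewrite mulrBr mulr1 => <-.
by ring.
Qed.

(** Dropping the horizontal part of [ch] leaves cosh of the difference of the log-heights. *)
Lemma ln_ht_dist u v : in_Hd u -> in_Hd v -> `|ln (ht u) - ln (ht v)| <= hdist u v.
Proof.
move=> uH vH; have u0 := ht_gt0 uH; have v0 := ht_gt0 vH.
have c1 := ch_ge1 uH vH.
have h : cosh (ln (ht u) - ln (ht v)) <= ch u v.
  rewrite -ln_div ?posrE // cosh_ln ?divr_gt0 // invf_div.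
  have -> : (ht u / ht v + ht v / ht u) / 2 = (ht u ^+ 2 + ht v ^+ 2) / (2 * ht u * ht v).
    by field; rewrite !gt_eqF.
  rewrite ler_pdivrMr ?mulr_gt0 // mulrC -ch_sum //; have := dx2_ge0 u v; lra.
by rewrite ler_norml lerNl opprB hdistE // !le_arcosh // -coshN opprB.
Qed.

Lemma hx_dist u v j : (hx u j - hx v j) ^+ 2 <= dx2 u v.
Proof. by rewrite /dx2 (bigD1 j) //= lerDl sumr_ge0 // => i _; rewrite sqr_ge0. Qed.

Lemma ht_le_exp u v x : in_Hd u -> in_Hd v -> hdist u v <= x -> ht u <= ht v * expR x.
Proof.
move=> uH vH ux; have u0 := ht_gt0 uH; have v0 := ht_gt0 vH.
rewrite -(lnK (u0 : ht u \is Num.pos)) -[X in X * _](lnK (v0 : ht v \is Num.pos)) -expRD ler_expR.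
by have := ln_ht_dist uH vH; rewrite ler_norml => /andP[_]; lra.
Qed.

Lemma dx2_le_exp u v x : in_Hd u -> in_Hd v -> hdist u v <= x ->
  dx2 u v <= 2 * (ht v * expR x) ^+ 2.
Proof.
move=> uH vH ux; have u0 := ht_gt0 uH; have v0 := ht_gt0 vH.
have d0 := hdist_ge0 uH vH.
have := dx2E uH vH; have := sqr_ge0 (ht u - ht v).
have c1 : cosh (hdist u v) - 1 <= expR x.
  have := cosh_le_expR d0; have : expR (hdist u v) <= expR x by rewrite ler_expR.
  by lra.
have h := ht_le_exp uH vH ux; have e0 := expR_gt0 x.
have : ht u * (cosh (hdist u v) - 1) <= ht v * expR x * expR x.
  by apply: ler_pM; [exact: ltW | rewrite subr_ge0 cosh_ge1 | exact: h | exact: c1].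
move: (cosh _) => c; nra.
Qed.

Lemma dx2_le_small u v x : in_Hd u -> in_Hd v -> hdist u v <= x -> x <= 1 ->
  dx2 u v <= (4 * x * ht v) ^+ 2.
Proof.
move=> uH vH ux x1; have u0 := ht_gt0 uH; have v0 := ht_gt0 vH.
have d0 := hdist_ge0 uH vH; have x0 : 0 <= x by lra.
have := dx2E uH vH; have := sqr_ge0 (ht u - ht v).
have e4 : expR x <= 4 by apply: le_trans (expR1_le4 R); rewrite ler_expR.
have e0 := expR_gt0 x.
have c1 : cosh (hdist u v) - 1 <= 2 * x ^+ 2.
  have := cosh_le_quadratic x0; have := cosh_le d0 ux; have := sqr_ge0 x; nra.
have h : ht u <= ht v * 4 by apply: le_trans (ht_le_exp uH vH ux) _; rewrite ler_pM2l.
have : ht u * (cosh (hdist u v) - 1) <= ht v * 4 * (2 * x ^+ 2).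
  by apply: ler_pM; [exact: ltW | rewrite subr_ge0 cosh_ge1 | exact: h | exact: c1].
move: (cosh _) => c; nra.
Qed.

Lemma arcosh_le_ln (t x : R) : 1 <= t -> 2 * t <= x -> arcosh t <= ln x.
Proof.
move=> t1 tx; have x0 : 0 < x by lra.
apply: arcosh_le => //; first by apply: ln_ge0; lra.
rewrite cosh_ln //; have : 0 < x^-1 by rewrite invr_gt0.
by lra.
Qed.

(** A hub is computed from a name and a single point, without knowledge of the partner; the pair
    enters only in the choice of the name. *)
Definition hub_family (eps theta L K : R) : Prop :=
  exists (F : finType) (f : F -> T -> T),
    [/\ #|F|%:R <= K, forall k z, in_Hd (f k z) &
      forall u v, in_Hd u -> in_Hd v -> L <= hdist u v < 2 * L ->
        exists k q, hdist u q + hdist q v <= hdist u v + eps / 2 * L /\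
          forall z, in_Hd z -> hdist z u <= theta * L \/ hdist z v <= theta * L -> f k z = q].

(* Every geodesic passes within a bounded distance of the point above its endpoints whose
   height is the Euclidean diameter of the pair, so rounding that height to a factor
   exp (eps L / 16) suffices when eps L is large. *)
Lemma hub_family_large (eps theta L : R) : 0 < eps <= 1 -> 16 * theta <= eps ->
  40 * m.+1%:R <= eps * L -> hub_family eps theta L (97 / eps * 16 ^+ m).
Proof.
move=> /andP[e0 e1] te eL.
have m0 : 0 <= m%:R :> R by [].
have eL40 : 40 <= eps * L by move: eL; rewrite -natr1; lra.
have L0 : 0 < L by nra.
have L1 : 40 <= L by nra.
pose h := eps * L / 16; have h0 : 0 < h by rewrite divr_gt0 // mulr_gt0.
have hL : h <= L / 16 by rewrite /h; nra.
have th : theta * L <= h by rewrite /h; nra.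
(* Half a window, [M / 2] steps of length h = eps L / 16, has to exceed 3 L. *)
pose M := (Num.truncn (96 / eps)).+1.
have Mgt : 96 / eps < M%:R.
  have : 0 <= 96 / eps by rewrite divr_ge0 // ltW.
  by move/truncn_itv => /andP[].
have Mle : M%:R <= 97 / eps.
  have h96 : 0 <= 96 / eps by rewrite divr_ge0 // ltW.
  have := truncn_itv h96 => /andP[+ _]; rewrite /M -natr1.
  have : 1 <= eps^-1 by rewrite invf_ge1.
  by lra.
pose hub (Y : R) (n : 'I_m -> int) : T := mkH (fun j => Y * (n j)%:~R) Y.
pose F : finType := ('I_M * {ffun 'I_m -> 'I_16})%type.
pose f (k : F) (p : T) : T := let Y := expR (h * (grid_pick M k.1 (ln (ht p) / h))%:~R) in
  hub Y (fun j => grid_pick 16 (k.2 j) (hx p j / Y)).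
exists F, f; split.
- rewrite card_prod card_ffun !card_ord natrM natrX.
  by apply: ler_wpM2r => //; rewrite exprn_ge0.
- by move=> k z; apply: mkH_in; apply: expR_gt0.
move=> u v uH vH /andP[Ld dL].
have y1 := ht_gt0 uH; have y2 := ht_gt0 vH; have D0 := dx2_ge0 u v.
have c1 := ch_ge1 uH vH; have sE := ch_sum uH vH.
have lnc : ln (ch u v) <= hdist u v.
  rewrite -(expRK (hdist u v)) ler_ln ?posrE ?expR_gt0 //; last lra.
  by rewrite -cosh_hdist // cosh_le_expR // hdist_ge0.
have lnc0 : 0 <= ln (ch u v) by apply: ln_ge0.
have ln2 : 0 <= ln (2 : R) <= 1.
  rewrite ln_ge0 ?ler1n //=; have := @le_ln1Dx R 1; rewrite -[1 + 1]/(2%:R); apply; lra.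
set c := ch u v in sE c1 lnc lnc0.
pose top := ln 2 + ln (ht u) + ln (ht v) + ln c.
have topE : expR top = dx2 u v + ht u ^+ 2 + ht v ^+ 2.
  by rewrite sE /top !expRD !lnK ?posrE //; lra.
(* The summand 2 puts h t between h and 2 h above [top / 2]. The margin of at least h makes [Y]
   dominate also the displacement of a point within h of an endpoint. *)
pose t := Num.floor (top / 2 / h) + 2.
have /andP[t1 t2] : top / 2 + h <= h * t%:~R <= top / 2 + 2 * h.
  have /andP[] := floor_itv (top / 2 / h); rewrite ler_pdivlMr // ltr_pdivrMr // /t !intrD.
  by move=> *; apply/andP; split; nra.
pose Y := expR (h * t%:~R); have Y0 : 0 < Y by apply: expR_gt0.
have Ytop : (dx2 u v + ht u ^+ 2 + ht v ^+ 2) * expR h ^+ 2 <= Y ^+ 2.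
  by rewrite -topE /Y !expr2 -!expRD ler_expR; lra.
have eh1 : 1 <= expR h by have := expR_ge1Dx h; lra.
have Ytop' : dx2 u v + ht u ^+ 2 + ht v ^+ 2 <= Y ^+ 2.
  apply: le_trans Ytop; apply: ler_peMr; last by rewrite expr_ge1 // ltW ?expR_gt0.
  by rewrite !addr_ge0 ?sqr_ge0.
pose n j := Num.floor (hx u j / Y).
pose q := hub Y n.
have qH : in_Hd q by apply: mkH_in.
have htq : ht q = Y by rewrite ht_mkH.
have hxq j : hx q j = Y * (n j)%:~R by rewrite hx_mkH.
have uq j : 0 <= hx u j - hx q j <= Y.
  by rewrite hxq; have /andP[-> /ltW ->] := floor_grid (hx u j) Y0.
have uvj j : `|hx u j - hx v j| <= Y.
  apply: norm_le_sqr; first exact: ltW.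
  apply: le_trans (hx_dist u v j) _; have := sqr_ge0 (ht u); have := sqr_ge0 (ht v); lra.
have wq w j : w = u \/ w = v -> `|hx w j - hx q j| <= 2 * Y.
  have u0 : 0 <= (1 - 0) * hx u j + 0 * hx v j - hx q j <= Y by rewrite subr0 mul1r mul0r addr0.
  have f0 : 0 <= (0 : R) <= 1 by rewrite lexx ler01.
  have [a1 a2] := near_chord_point f0 (uvj j) u0.
  by rewrite mulr_natl mulr2n; case=> ->.
have wY w : w = u \/ w = v -> ht w ^+ 2 <= dx2 u v + ht u ^+ 2 + ht v ^+ 2.
  by case=> ->; [rewrite addrAC | ]; rewrite lerDr addr_ge0 ?sqr_ge0.
have dq w : in_Hd w -> w = u \/ w = v -> hdist w q <= ln (4 * m%:R + 2) + h * t%:~R - ln (ht w).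
  move=> wH wuv; have w0 := ht_gt0 wH.
  have c4 : 0 < 4 * m%:R + 2 :> R by lra.
  have -> : ln (4 * m%:R + 2) + h * t%:~R - ln (ht w) = ln ((4 * m%:R + 2) * Y / ht w).
    by rewrite ln_div ?posrE ?mulr_gt0 // lnM ?posrE // expRK.
  rewrite hdistE //; apply: arcosh_le_ln; first exact: ch_ge1.
  rewrite ler_pdivlMr // -(ler_pM2r Y0).
  have -> : 2 * ch w q * ht w * Y = 2 * ht w * ht q * ch w q by rewrite htq; ring.
  rewrite -ch_sum // htq.
  have : dx2 w q <= \sum_(j < m) 4 * Y ^+ 2.
    apply: ler_sum => j _; have -> : 4 * Y ^+ 2 = (2 * Y) ^+ 2 by ring.
    rewrite -real_normK ?num_real // ler_pXn2r ?nnegrE ?wq //; by rewrite mulr_ge0 // ltW.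
  rewrite sumr_const card_ord -mulr_natl; have := le_trans (wY w wuv) Ytop'.
  by nra.
have [k1 k1P] := @grid_pickP R M t (ltn0Sn _).
have /fin_all_exists[k2 k2P] : forall j : 'I_m, exists k : 'I_16,
   forall x : R, `|x - (n j)%:~R| < 16%:R / 2 -> grid_pick 16 k x = n j.
  by move=> j; apply: grid_pickP.
exists (k1, [ffun j => k2 j]), q; split.
  (* The sum exceeds [hdist u v] by at most 2 ln (4 m + 2) + ln 2 + 4 h. Here 4 h is half of the
     allowance eps L / 2, and 40 (m + 1) <= eps L pays for the rest. *)
  have := dq u uH (or_introl erefl); have := dq v vH (or_intror erefl).
  rewrite (hdistC vH qH).
  have : ln (4 * m%:R + 2) <= 4 * m%:R + 2 :> R by apply/ltW/ln_sublinear; lra.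
  have : h = eps * L / 16 by [].
  have topd : top = ln 2 + ln (ht u) + ln (ht v) + ln c by [].
  case/andP: ln2 => l1 l2; move: eL; rewrite -natr1.
  have : h * t%:~R <= top / 2 + 2 * (eps * L / 16) by [].
  move: l1 l2 lnc m0; rewrite topd.
  move: (h * t%:~R) (ln (4 * m%:R + 2)) (ln 2) (ln (ht u)) (ln (ht v)) (ln c); clear.
  by move=> *; lra.
have near w z : in_Hd w -> w = u \/ w = v -> in_Hd z -> hdist z w <= theta * L ->
    f (k1, [ffun j => k2 j]) z = q.
  move=> wH wuv zH zw; have zwh : hdist z w <= h by lra.
  have lzw := ln_ht_dist zH wH.
  rewrite /f /=.
  have -> : grid_pick M k1 (ln (ht z) / h) = t.
    apply: k1P.
    have -> : ln (ht z) / h - t%:~R = (ln (ht z) - h * t%:~R) / h by field; rewrite gt_eqF.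
    rewrite normrM [`|h^-1|]gtr0_norm ?invr_gt0 // ltr_pdivrMr //.
    apply: (@le_lt_trans _ _ (3 * L)).
      have [l1 l2] := andP ln2.
      have lwu : ln (ht w) = ln (ht u) \/ ln (ht w) = ln (ht v) by case: wuv => ->; [left|right].
      exact: (large_window (erefl top) l1 l2 lnc0 lnc dL (ln_ht_dist uH vH) lwu
        (le_trans lzw zwh) h0 hL L1 t1 t2).
    have -> : 3 * L = (96 / eps) / 2 * h by rewrite /h; field; rewrite gt_eqF.
    by rewrite (ltr_pM2r h0) ltr_pM2r ?invr_gt0.
  rewrite -/Y; congr mkH; apply: funext => j; rewrite ffunE k2P //.
  have -> : hx z j / Y - (n j)%:~R = (hx z j - hx q j) / Y.
    by rewrite hxq; field; rewrite gt_eqF.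
  rewrite normrM [`|Y^-1|]gtr0_norm ?invr_gt0 // ltr_pdivrMr //.
  have hzw : `|hx z j - hx w j| <= 2 * Y.
    apply: norm_le_sqr; first by rewrite mulr_ge0 // ltW.
    apply: le_trans (hx_dist z w j) _; apply: le_trans (dx2_le_exp zH wH zwh) _.
    have := ler_wpM2r (sqr_ge0 (expR h)) (wY w wuv); rewrite exprMn.
    move=> h1; have -> : (2 * Y) ^+ 2 = 2 * Y ^+ 2 + 2 * Y ^+ 2 by ring.
    by apply: ler_wpDr; [rewrite mulr_ge0 ?sqr_ge0 | rewrite ler_wpM2l // (le_trans h1)].
  apply: le_lt_trans (ler_distD (hx w j) _ _) _.
  exact: le_lt_trans (lerD hzw (wq w j wuv)) (four_lt_eight Y0).
by move=> z zH [zu|zv]; [apply: (near u) => //; left | apply: (near v) => //; right].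
Qed.

End HubBasics.

(** * Real inequalities along a geodesic chord *)

(** [H] is the squared height of the geodesic over the horizontal midpoint and [F] the one at
    fraction [f]; they differ by (f - 1/2) (y2^2 - y1^2) - (f - 1/2)^2 D. The bounds with [lam] are
    the sharper ones for close pairs. *)
Lemma chord_height (R : realType) (f y1 y2 D lam : R) :
  4^-1 <= f <= 3 / 4 -> 0 < y1 -> y1 <= y2 -> 0 <= D -> 0 < lam -> lam <= 1 ->
  D + (y1 - y2) ^+ 2 <= (8 * lam * y2) ^+ 2 \/ lam = 1 ->
  let H := (y1 ^+ 2 + y2 ^+ 2) / 2 + D / 4 in
  let F := (1 - f) * y1 ^+ 2 + f * y2 ^+ 2 + f * (1 - f) * D in
  H / 2 <= F <= 3 / 2 * H /\ (1 - 16 * lam) * H <= F <= (1 + 16 * lam) * H.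
Proof.
move=> /andP[f1 f2] y1_ y12 D_ l0 l1 alt H F.
have y2_ : 0 < y2 by lra.
have sy1 : 0 < y1 ^+ 2 by rewrite exprn_gt0.
have H0 : 0 < H by have := sqr_ge0 y2; rewrite /H; lra.
have G0 : 0 <= y2 ^+ 2 - y1 ^+ 2 by rewrite subr_ge0; apply: sqr_mono => //; exact: ltW.
have FE : F - H = (f - 2^-1) * (y2 ^+ 2 - y1 ^+ 2) - (f - 2^-1) ^+ 2 * D by rewrite /F /H; field.
have b1 : (f - 2^-1) * (y2 ^+ 2 - y1 ^+ 2) <= 4^-1 * (y2 ^+ 2 - y1 ^+ 2) by apply: ler_wpM2r => //; lra.
have b2 : - 4^-1 * (y2 ^+ 2 - y1 ^+ 2) <= (f - 2^-1) * (y2 ^+ 2 - y1 ^+ 2) by apply: ler_wpM2r => //; lra.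
have b3 : (f - 2^-1) ^+ 2 * D <= 16^-1 * D by apply: ler_wpM2r => //; nra.
have b4 : 0 <= (f - 2^-1) ^+ 2 * D by rewrite mulr_ge0 // sqr_ge0.
have bb : `|F - H| <= 4^-1 * (y2 ^+ 2 - y1 ^+ 2) + D / 16.
  by rewrite FE ler_norml; apply/andP; split; lra.
have bh : `|F - H| <= H / 2 by apply: le_trans bb _; rewrite /H; lra.
have bl : `|F - H| <= 16 * lam * H.
  case: alt => [up|lE]; last by apply: le_trans bh _; rewrite lE; lra.
  have up1 : `|y1 - y2| <= 8 * lam * y2.
    apply: norm_le_sqr; first by rewrite !mulr_ge0 // ltW.
    by apply: le_trans up; rewrite lerDr.
  have up2 : (y2 - y1) * (y2 + y1) <= 8 * lam * y2 * (2 * y2).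
    by apply: ler_pM; move: up1; rewrite ?ler_norml; [lra | lra | move=> /andP[]; lra | lra].
  have up3 : D <= 64 * (lam * y2 ^+ 2).
    apply: (@le_trans _ _ (64 * (lam ^+ 2 * y2 ^+ 2))).
      have -> : 64 * (lam ^+ 2 * y2 ^+ 2) = (8 * lam * y2) ^+ 2 by ring.
      by apply: le_trans up; rewrite lerDl sqr_ge0.
    have ll : lam ^+ 2 <= lam by rewrite expr2 ler_piMl // ltW.
    by have := ler_wpM2r (sqr_ge0 y2) ll; lra.
  apply: le_trans bb _.
  have : lam * y2 ^+ 2 <= lam * (2 * H) by rewrite ler_pM2l //; rewrite /H; lra.
  by move: up2 up3; lra.
by move: bh bl; rewrite !ler_norml => /andP[c1 c2] /andP[c3 c4]; split; apply/andP; split; lra.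
Qed.

Lemma ln_close (R : realType) (h y lam : R) : 0 < h -> 0 < y -> 0 < lam -> h ^+ 2 / 2 <= y ^+ 2 ->
  (1 - 16 * lam) * h ^+ 2 <= y ^+ 2 -> y ^+ 2 <= (1 + 16 * lam) * h ^+ 2 ->
  ln h - 16 * lam <= ln y <= ln h + 16 * lam.
Proof.
move=> h0 y0 l0 FH1 FH3 FH4; have ex := expR_ge1Dx (32 * lam).
have H0 : 0 < h ^+ 2 by rewrite exprn_gt0.
have F0 : 0 < y ^+ 2 by rewrite exprn_gt0.
have lnF : ln (y ^+ 2) = 2 * ln y by rewrite lnXn // mulr2n; ring.
have lnH : ln (h ^+ 2) = 2 * ln h by rewrite lnXn // mulr2n; ring.
move: lnF lnH FH1 FH3 FH4 H0 F0; set F := y ^+ 2; set H := h ^+ 2 => lnF lnH FH1 FH3 FH4 H0 F0.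
have h1 : ln F <= 32 * lam + ln H.
  rewrite -(expRK (32 * lam)) -lnM ?posrE ?expR_gt0 // ler_ln ?posrE ?mulr_gt0 ?expR_gt0 //.
  by apply: le_trans FH4 _; rewrite ler_pM2r //; lra.
have h2 : ln H <= 32 * lam + ln F.
  rewrite -(expRK (32 * lam)) -lnM ?posrE ?expR_gt0 // ler_ln ?posrE ?mulr_gt0 ?expR_gt0 //.
  apply: (@le_trans _ _ ((1 + 32 * lam) * F)); last by rewrite ler_pM2r.
  (* For large [lam] the factor 1 - 16 lam is useless and F >= H / 2 is used instead; for 32 lam < 1
     the product (1 + 32 lam) (1 - 16 lam) is at least 1. *)
  have [c|c] := leP 1 (32 * lam).
    by apply: (@le_trans _ _ (2 * F)); [lra | rewrite ler_pM2r //; lra].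
  apply: (@le_trans _ _ ((1 + 32 * lam) * ((1 - 16 * lam) * H))); last first.
    by rewrite ler_pM2l //; lra.
  by rewrite mulrA; apply: ler_peMl; [exact: ltW | nra].
by apply/andP; split; lra.
Qed.

Lemma middle_facts (R : realType) (f : R) : 4^-1 <= f -> f <= 3 / 4 ->
  [/\ 0 < f, 0 < 1 - f, 0 < f < 1 & 0 <= f <= 1].
Proof. by move=> f1 f2; split; try (apply/andP; split); lra. Qed.

Lemma fine_label (R : realType) (l l0 s sig lam rho : R) : 0 < lam -> 0 < rho ->
  l0 - 16 * lam <= l <= l0 + 16 * lam -> 0 <= l0 - s -> l0 - s <= sig -> sig <= lam ->
  0 <= (l - s + 17 * lam) / rho /\ (l - s + 17 * lam) / rho * rho <= 80 * lam.
Proof.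
move=> lam0 rho0 /andP[h1 h2] h3 h4 h5; split; first by rewrite divr_ge0 ?(ltW rho0) //; lra.
by rewrite divfK ?gt_eqF //; lra.
Qed.

Lemma ln_window (R : realType) (l0 l1 l2 s sig L : R) :
  l1 + l2 <= 2 * l0 -> 2 * l0 <= l1 + l2 + 2 * L -> l2 - l1 < 2 * L ->
  0 <= l0 - s -> l0 - s <= sig -> sig <= L / 32 -> l1 <= l2 -> 0 < L ->
  `|l1 - s| <= 3 * L /\ `|l2 - s| <= 3 * L.
Proof. by move=> *; rewrite !ler_norml; split; apply/andP; split; lra. Qed.

Lemma window_sum (R : realType) (lam rho Y : R) : 0 <= lam * Y -> rho * Y <= lam * Y ->
  12 * lam * Y + rho * Y <= 28 * lam * Y.
Proof. by lra. Qed.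

Lemma ln_between (R : realType) (l1 l2 l L : R) : l1 <= l <= l2 -> l2 - l1 < 2 * L -> 0 < L ->
  `|l1 - l| <= 3 * L /\ `|l2 - l| <= 3 * L.
Proof. by move=> /andP[? ?] *; rewrite !ler_norml; split; apply/andP; split; lra. Qed.

Lemma inner_facts (R : realType) (f : R) : 1 <= 5 * f -> 1 <= 4 * (1 - f) ->
  [/\ 20^-1 <= f * (1 - f), 0 < f * (1 - f) & 0 < f < 1].
Proof.
move=> f5 f4; have h : 20^-1 <= f * (1 - f) by nra.
by split=> //; [lra | apply/andP; split; lra].
Qed.

(** The right side is the square of 2 y1 y2 sinh of the distance, so this supplies [W] in
    [detour_le] for steep pairs. *)
Lemma vertical_width (R : realType) (D y1 y2 lam : R) : 0 <= D -> 0 < y1 -> 0 < y2 -> 0 < lam ->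
  lam * y2 <= 4 * (y2 - y1) ->
  (lam * y2 ^+ 2 / 4) ^+ 2 <= (D + (y1 - y2) ^+ 2) * (D + (y1 + y2) ^+ 2).
Proof.
move=> D_ y10 y20 l0 gap; have ly : 0 < lam * y2 by rewrite mulr_gt0.
have -> : (lam * y2 ^+ 2 / 4) ^+ 2 = (lam * y2 / 4) ^+ 2 * y2 ^+ 2 by field.
apply: ler_pM; rewrite ?sqr_ge0 //.
  have -> : (y1 - y2) ^+ 2 = (y2 - y1) ^+ 2 by ring.
  apply: (@le_trans _ _ ((y2 - y1) ^+ 2)); last by rewrite lerDr.
  by apply: sqr_mono; lra.
by apply: (@le_trans _ _ ((y1 + y2) ^+ 2)); [apply: sqr_mono; lra | rewrite lerDr].
Qed.

Lemma rounding_bounds (R : realType) (a r l A B : R) (k : nat) :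
  a * r = l - A + B -> k%:R * r <= a * r -> a * r < k.+1%:R * r ->
  A + (r * k%:R - B) <= l /\ l <= A + (r * k%:R - B) + r.
Proof. by move=> ->; rewrite -natr1 => h1 h2; split; lra. Qed.

(** The counterpart of [vertical_width] for flat pairs: it supplies [W] when the horizontal distance
    is large. *)
Lemma chord_width (R : realType) (F y1 y2 D lam : R) :
  0 <= F -> 0 < y1 -> y1 <= y2 -> 0 <= D -> 0 < lam -> lam <= 1 -> (lam * y2) ^+ 2 <= 16 * D ->
  F <= 3 / 2 * ((y1 ^+ 2 + y2 ^+ 2) / 2 + D / 4) ->
  (lam * F / 7) ^+ 2 <= (D + (y1 - y2) ^+ 2) * (D + (y1 + y2) ^+ 2).
Proof.
move=> F0 y1_ y12 D_ l0 l1 DH FH.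
have sl0 : 0 < lam ^+ 2 by rewrite exprn_gt0.
have sl1 : lam ^+ 2 <= 1 by rewrite expr_le1 // ltW.
have FB : F <= 3 / 2 * (y2 ^+ 2 + D).
  apply: le_trans FH _; apply: ler_wpM2l; first lra.
  have : y1 ^+ 2 <= y2 ^+ 2 by apply: sqr_mono => //; exact: ltW.
  by have := sqr_ge0 y2; lra.
have lB : lam ^+ 2 * (y2 ^+ 2 + D) <= 17 * D.
  have : lam ^+ 2 * D <= D by rewrite ler_piMl.
  by move: DH; rewrite exprMn; lra.
have B0 : 0 <= y2 ^+ 2 + D by have := sqr_ge0 y2; lra.
have up : D * (y2 ^+ 2 + D) <= (D + (y1 - y2) ^+ 2) * (D + (y1 + y2) ^+ 2).
  apply: ler_pM => //; first by rewrite lerDl sqr_ge0.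
  by rewrite addrC lerD2l; apply: sqr_mono; lra.
apply: le_trans up.
have FF : F ^+ 2 <= (3 / 2 * (y2 ^+ 2 + D)) ^+ 2 by apply: sqr_mono.
have -> : (lam * F / 7) ^+ 2 = lam ^+ 2 * F ^+ 2 / 49 by field.
have : lam ^+ 2 * F ^+ 2 <= lam ^+ 2 * (3 / 2 * (y2 ^+ 2 + D)) ^+ 2 by rewrite ler_pM2l.
have : lam ^+ 2 * (y2 ^+ 2 + D) * (y2 ^+ 2 + D) <= 17 * D * (y2 ^+ 2 + D).
  by apply: ler_wpM2r.
have : 0 <= D * (y2 ^+ 2 + D) by rewrite mulr_ge0.
by move: (lam ^+ 2) (F ^+ 2) (y2 ^+ 2) => A B C; lra.
Qed.

(** The budget of a flat pair: [A] stands for eps L, [mu] for the number of horizontal axes, [r2]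
    for rho^2. The losses 2, 7, 4 and 16 (from W, the height ratio and f (1 - f) >= 3 / 16) multiply
    to 896, below 1024. *)
Lemma chord_excess (R : realType) (ym yq f lam A S F mu r2 : R) :
  4^-1 <= f <= 3 / 4 -> 0 < ym -> 0 < yq -> 0 < F -> 0 < lam -> 0 < A -> 0 < r2 -> 1 <= mu ->
  ym <= 4 * yq -> 1024 * mu * r2 <= A * lam -> S <= mu * r2 * (2 * F) + r2 * F ->
  ym * S / (yq * (f * (1 - f)) * (lam * F / 7)) <= A / 2.
Proof.
move=> /andP[f1 f2] ymp yq0 F0 l0 A0 r20 mu1 ym4 rhoE SE.
have f16 : 3 / 16 <= f * (1 - f) by nra.
have ff0 : 0 < f * (1 - f) by lra.
rewrite ler_pdivrMr; last by rewrite mulr_gt0 ?(mulr_gt0 yq0 ff0) // divr_gt0 // mulr_gt0.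
have Al0 : 0 < A * lam by rewrite mulr_gt0.
have SF : S <= 3 * (A * lam / 1024) * F.
  have : r2 * F <= mu * r2 * F by rewrite ler_pM2r // ler_peMl // ltW.
  have : mu * r2 * F <= A * lam / 1024 * F by rewrite ler_pM2r //; lra.
  by move: SE; lra.
have r2' : ym * S <= ym * (3 * (A * lam / 1024) * F) by rewrite ler_pM2l.
have r3 : ym * 4^-1 * (3 / 16) <= yq * (f * (1 - f)).
  by apply: ler_pM => //; rewrite ?mulr_ge0 ?(ltW ymp) //; lra.
have r4 : (A * lam / 14 * F) * (ym * 4^-1 * (3 / 16)) <= (A * lam / 14 * F) * (yq * (f * (1 - f))).
  by rewrite ler_pM2l // mulr_gt0 // divr_gt0.
have r5 : 0 <= A * lam * F * ym by rewrite mulr_ge0 ?(ltW ymp) // mulr_ge0 // ltW.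
by move: r2' r4 r5; move: (yq * _) => B; lra.
Qed.

Lemma height_rounding (R : realType) (y b rho : R) : 0 < y -> 0 < rho -> rho <= 1 ->
  b <= ln y -> ln y <= b + rho ->
  [/\ expR b <= y, y <= 4 * expR b & y - expR b <= rho * y].
Proof.
move=> y0 r0 r1 b1 b2; have yE : y = expR (ln y) by rewrite lnK.
split; first by rewrite yE ler_expR.
  apply: (@le_trans _ _ (expR rho * expR b)); first by rewrite {1}yE -expRD ler_expR; lra.
  by rewrite ler_pM2r ?expR_gt0 // (le_trans _ (expR1_le4 R)) // ler_expR.
have : y * expR (- rho) <= expR b by rewrite {1}yE -expRD ler_expR; lra.
by have := expR_ge1Dx (- rho); move: (expR (- rho)) => x; nra.
Qed.

(** The middle half of the chord has length at least [s] along this axis, so it contains a multiple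
    of [s]; staying in it keeps the crossing away from both endpoints. *)
Lemma plane_crossing (R : realType) (x d s : R) : 0 < s -> 2 * s <= `|d| ->
  exists (n : int) (f : R), 4^-1 <= f <= 3 / 4 /\ x + f * d = s * n%:~R.
Proof.
move=> s0 sd; have [d0|d0] := leP 0 d.
  rewrite ger0_norm // in sd; have dp : 0 < d by lra.
  have /andP[h1 h2] := floor_grid (x + 3 / 4 * d) s0.
  set n := Num.floor _ in h1 h2; exists n, ((s * n%:~R - x) / d); split; last first.
    by rewrite divfK ?gt_eqF // addrC subrK.
  by rewrite ler_pdivlMr // ler_pdivrMr //; apply/andP; split; lra.
rewrite ltr0_norm // in sd; have dp : 0 < - d by lra.
have /andP[h1 h2] := floor_grid (x + 4^-1 * d) s0.
set n := Num.floor _ in h1 h2; exists n, ((x - s * n%:~R) / - d); split; last first.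
  by rewrite invrN mulrN mulNr divfK ?lt_eqF // opprB addrC subrK.
by rewrite ler_pdivlMr // ler_pdivrMr //; apply/andP; split; lra.
Qed.

(** * Hub names while eps L is at most of order d *)

Section SmallScale.
Variables (R : realType) (m : nat).
Notation T := (hpoint R m.+1).
Variables (eps theta L lam rho : R) (M N : nat).
Hypotheses (m0 : (0 < m)%N) (e0 : 0 < eps) (th0 : 0 <= theta) (th1 : theta <= 1)
  (thL : theta * L <= 1) (L0 : 0 < L)
  (lamE : lam = L /\ L <= 1 \/ lam = 1 /\ 1 <= L)
  (rho0 : 0 < rho) (rhol : rho <= lam)
  (rhoE : 1024 * m%:R * rho ^+ 2 <= eps * L * lam)
  (ME : 256 * L < M%:R * lam) (NE : 80 * lam < N%:R * rho).

Let lam0 : 0 < lam. Proof. by case: lamE => -[-> _]. Qed.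
Let lam1 : lam <= 1. Proof. by case: lamE => -[-> ]. Qed.
Let lamL : lam <= L. Proof. by case: lamE => -[-> ]. Qed.
Let thl : theta * L <= lam.
Proof. by case: lamE => -[-> h] //; move: L0 th1; nra. Qed.
Let mR : 1 <= m%:R :> R. Proof. by rewrite ler1n. Qed.

(** The spacing of the hyperplanes is small enough for the middle half of a flat chord to meet one
    along its longest axis. With 1000 m labels, half a window is 50 lam, more than the 40 lam needed
    for robustness. *)
Let sigc := lam / (10 * m%:R).
Let sigc0 : 0 < sigc. Proof. by rewrite divr_gt0 // mulr_gt0 // ltr0n. Qed.
Let Nc := (1000 * m)%N.

(* kind = None: horosphere; kind = Some i: vertical hyperplanes orthogonal to the i-th
   axis, where the label of the i-th axis encodes the height instead; its logarithm stays within
   16 lam + lam / 32 of that of the reference height, whence the offset 17 lam. *)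
Definition spacing (kind : option 'I_m) (j : 'I_m) : R := if kind == Some j then sigc else rho.
Definition ref_height (t : int) : R := expR (lam / 32 * t%:~R).
Definition hub_height (kind : option 'I_m) (Y : R) (k : 'I_m -> nat) : R :=
  if kind is Some i then Y * expR (rho * (k i)%:R - 17 * lam) else Y.

Definition small_label : finType := (option 'I_m * 'I_M * 'I_Nc * {ffun 'I_m -> 'I_N})%type.

Definition small_hub (l : small_label) (p : T) : T :=
  let: (kind, tau, c, k) := l in
  let Y := ref_height (grid_pick M tau (ln (ht p) / (lam / 32))) in
  mkH (fun j => spacing kind j * Y *
         (if kind == Some j then grid_pick Nc c (hx p j / (spacing kind j * Y))
          else grid_pick N (k j) (hx p j / (spacing kind j * Y)))%:~R)
      (hub_height kind Y (fun i => k i)).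

Lemma spacing_gt0 kind j : 0 < spacing kind j.
Proof. by rewrite /spacing; case: ifP. Qed.

Lemma hub_height_gt0 kind Y k : 0 < Y -> 0 < hub_height kind Y k.
Proof. by move=> Y0; case: kind => [i|] //=; rewrite mulr_gt0 ?expR_gt0. Qed.

Lemma small_hub_in l p : in_Hd (small_hub l p).
Proof.
case: l => [[[kind tau] c] k]; apply: mkH_in; apply: hub_height_gt0; exact: expR_gt0.
Qed.

(** A point within theta L of [w] is horizontally within 4 lam [ht w] <= 12 lam Y of it; with the 28
    lam Y from [w] to the hub this makes 40 lam Y, less than half of every window. *)
Lemma window (kind : option 'I_m) (t : int) (n : 'I_m -> int) (h : 'I_m -> nat) :
  (forall j, (h j < N)%N) ->
  let Y := ref_height t in
  let q := mkH (fun j => spacing kind j * Y * (n j)%:~R) (hub_height kind Y h) in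
  exists l, forall w z, in_Hd w -> in_Hd z -> hdist z w <= theta * L ->
    `|ln (ht w) - lam / 32 * t%:~R| <= 3 * L -> ht w <= 3 * Y ->
    (forall j, `|hx w j - hx q j| <= 28 * lam * Y) -> small_hub l z = q.
Proof.
move=> hN Y q; have Y0 : 0 < Y by apply: expR_gt0.
have q0 : 0 < hub_height kind Y h by apply: hub_height_gt0.
have M0 : (0 < M)%N.
  by rewrite lt0n; apply: contraTneq ME => ->; rewrite mul0r -leNgt mulr_ge0 // ltW.
have N0 : (0 < N)%N.
  by rewrite lt0n; apply: contraTneq NE => ->; rewrite mul0r -leNgt mulr_ge0 // ltW.
have Nc0 : (0 < Nc)%N by rewrite muln_gt0.
have [tau tauP] := @grid_pickP R M t M0.
have /fin_all_exists[c cP] : forall j : 'I_m, exists k : 'I_Nc,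
   forall x : R, `|x - (n j)%:~R| < Nc%:R / 2 -> grid_pick Nc k x = n j.
  by move=> j; apply: grid_pickP.
have /fin_all_exists[k kP] : forall j : 'I_m, exists k : 'I_N,
   forall x : R, `|x - (n j)%:~R| < N%:R / 2 -> grid_pick N k x = n j.
  by move=> j; apply: grid_pickP.
pose c0 : 'I_Nc := if kind is Some i then c i else Ordinal Nc0.
pose k0 := [ffun j => if kind == Some j then Ordinal (hN j) else k j].
have hk : hub_height kind Y (fun i => k0 i) = hub_height kind Y h.
  by rewrite /k0 /hub_height; case: (kind) => [i|//]; rewrite ffunE eqxx.
exists (kind, tau, c0, k0) => w z wH zH zw lw wY wq.
have w0 := ht_gt0 wH.
have thL0 : 0 <= theta * L by rewrite mulr_ge0 // ltW.
have l32 : 0 < lam / 32 by rewrite divr_gt0.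
have tE : grid_pick M tau (ln (ht z) / (lam / 32)) = t.
  apply: tauP.
  have -> : ln (ht z) / (lam / 32) - t%:~R = (ln (ht z) - lam / 32 * t%:~R) / (lam / 32).
    by field; rewrite gt_eqF.
  rewrite normrM [`|_^-1|]gtr0_norm ?invr_gt0 // ltr_pdivrMr //.
  apply: (@le_lt_trans _ _ (4 * L)); last by move: ME; lra.
  have := ln_ht_dist zH wH; move: lw zw thL0 thl lamL; rewrite !ler_norml.
  by move: (lam / 32 * _) => s /andP[a1 a2] b1 b2 b3 b4 /andP[c1 c2]; apply/andP; split; lra.
rewrite /small_hub tE -/(ref_height t) -/Y /q hk; congr mkH.
apply: funext => j; have s0 := spacing_gt0 kind j; set s := spacing kind j in s0 *.
congr (_ * _%:~R).
have near : `|hx z j - s * Y * (n j)%:~R| <= 40 * lam * Y.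
  have := wq j; rewrite hx_mkH //.
  have : `|hx z j - hx w j| <= 12 * lam * Y.
    apply: norm_le_sqr; first by rewrite !mulr_ge0 // ltW.
    apply: le_trans (hx_dist z w j) _; apply: le_trans (dx2_le_small zH wH zw thL) _.
    have A : 0 <= 4 * (theta * L) * ht w by rewrite mulr_ge0 ?(ltW w0) // mulr_ge0.
    have B : 0 <= 12 * lam * Y by rewrite mulr_ge0 ?(ltW Y0) // mulr_ge0 // ltW.
    rewrite ler_sqr ?nnegrE //.
    have : theta * L * ht w <= lam * (3 * Y) by apply: ler_pM => //; exact: ltW.
    by lra.
  rewrite -/s !ler_norml => /andP[a1 a2] /andP[b1 b2].
  by apply/andP; split; lra.
have scale (K : nat) : 80 * lam < K%:R * s -> `|hx z j / (s * Y) - (n j)%:~R| < K%:R / 2.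
  move=> Kb.
  have -> : hx z j / (s * Y) - (n j)%:~R = (hx z j - s * Y * (n j)%:~R) / (s * Y).
    by field; rewrite !gt_eqF.
  rewrite normrM [`|_^-1|]gtr0_norm ?invr_gt0 ?mulr_gt0 // ltr_pdivrMr ?mulr_gt0 //.
  apply: le_lt_trans near _; nra.
case: ifP => kj; last by rewrite /k0 ffunE kj kP //; apply: scale; rewrite /s /spacing kj.
have -> : c0 = c j by rewrite /c0 (eqP kj).
rewrite cP //; apply: scale; rewrite /s /spacing kj /sigc natrM.
have -> : 1000 * m%:R * (lam / (10 * m%:R)) = 100 * lam by field; rewrite gt_eqF // ltr0n.
by move: lam0; lra.
Qed.

(** * Steep and flat pairs at one scale *)

Section Pair.
Variables (u v : T).
Hypotheses (uH : in_Hd u) (vH : in_Hd v) (uv : ht u <= ht v)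
  (Ld : L <= hdist u v) (dL : hdist u v < 2 * L).

Let y1 := ht u. Let y2 := ht v. Let D := dx2 u v.
Let y10 : 0 < y1. Proof. exact: ht_gt0. Qed.
Let y20 : 0 < y2. Proof. exact: ht_gt0. Qed.
Let D0 : 0 <= D. Proof. exact: dx2_ge0. Qed.

Lemma pair_lower : lam ^+ 2 * (y1 * y2) <= 2 * (D + (y1 - y2) ^+ 2).
Proof.
rewrite dx2E //.
have : 1 + lam ^+ 2 / 4 <= cosh (hdist u v).
  apply: le_trans (cosh_le (ltW lam0) (le_trans lamL Ld)).
  by apply: cosh_ge_quadratic; move: lam0 lam1; lra.
have : 0 < y1 * y2 by apply: mulr_gt0.
by rewrite -/y1 -/y2; move: (cosh _) (lam ^+ 2) => x l; nra.
Qed.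

Lemma pair_upper : lam = L -> D + (y1 - y2) ^+ 2 <= (8 * lam * y2) ^+ 2.
Proof.
move=> lE; have := dx2E uH vH; rewrite -/D -/y1 -/y2 => ->.
have d0 : 0 <= hdist u v by apply: hdist_ge0.
have l0 := lam0; have l1 := lam1.
have c1 : cosh (hdist u v) - 1 <= 32 * lam ^+ 2.
  have h2 : 0 <= 2 * lam by lra.
  have := cosh_le_quadratic h2; have : cosh (hdist u v) <= cosh (2 * lam).
    by apply: cosh_le => //; rewrite lE ltW.
  have : expR (2 * lam) <= 16.
    have -> : 2 * lam = lam + lam by ring.
    rewrite expRD; have := expR1_le4 R; have : expR lam <= expR 1 by rewrite ler_expR.
    by have := expR_gt0 lam; nra.
  by have := sqr_ge0 lam; move: (lam) (expR _) (cosh _) (cosh _) => a b x y; nra.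
have c0 : 0 <= cosh (hdist u v) - 1 by rewrite subr_ge0 cosh_ge1.
have y12 : y1 * (cosh (hdist u v) - 1) <= y2 * (32 * lam ^+ 2).
  by apply: ler_pM => //; exact: ltW.
by move: y20 y12; move: (cosh _) => x; nra.
Qed.

Lemma ln_pair : ln y2 - ln y1 < 2 * L.
Proof. by have := ln_ht_dist uH vH; rewrite ler_norml => /andP[+ _]; rewrite -/y1 -/y2; move: dL; lra. Qed.

Lemma pair_window (kind : option 'I_m) (t : int) (n : 'I_m -> int) (h : 'I_m -> nat) :
  (forall j, (h j < N)%N) ->
  let Y := ref_height t in
  let q := mkH (fun j => spacing kind j * Y * (n j)%:~R) (hub_height kind Y h) in
  `|ln y1 - lam / 32 * t%:~R| <= 3 * L -> `|ln y2 - lam / 32 * t%:~R| <= 3 * L -> y2 <= 3 * Y ->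
  (forall j, `|hx u j - hx q j| <= 28 * lam * Y /\ `|hx v j - hx q j| <= 28 * lam * Y) ->
  exists l, forall z, in_Hd z ->
    hdist z u <= theta * L \/ hdist z v <= theta * L -> small_hub l z = q.
Proof.
move=> hN Y q h1 h2 yY hq; have [l lP] := window kind t n hN.
exists l => z zH [zu|zv].
- by apply: (lP u) => // [|j]; [exact: le_trans uv yY | have [] := hq j].
- by apply: (lP v) => // j; have [] := hq j.
Qed.

Lemma ln_mid_height :
  ln y1 + ln y2 <= ln ((y1 ^+ 2 + y2 ^+ 2) / 2 + D / 4) <= ln y1 + ln y2 + 2 * L.
Proof.
set H := _ / 2 + D / 4; have y1_ := y10; have y2_ := y20; have D_ := D0.
have H0 : 0 < H.
  have a1 : 0 < y1 ^+ 2 by rewrite exprn_gt0.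
  have a2 : 0 < y2 ^+ 2 by rewrite exprn_gt0.
  by rewrite /H; move: a1 a2 D_; lra.
rewrite -lnM ?posrE //; apply/andP; split.
  by rewrite ler_ln ?posrE ?mulr_gt0 //; have := sqr_ge0 (y1 - y2); rewrite /H; move: D_; lra.
rewrite -(expRK (2 * L)) -lnM ?posrE ?mulr_gt0 ?expR_gt0 //.
rewrite ler_ln ?posrE ?mulr_gt0 ?expR_gt0 //.
have hc : ch u v <= expR (2 * L).
  rewrite -cosh_hdist //; apply: le_trans (cosh_le_expR (hdist_ge0 uH vH)) _.
  by rewrite ler_expR ltW.
have := ch_sum uH vH; rewrite -/y1 -/y2 -/D => hs.
have : y1 * y2 * ch u v <= y1 * y2 * expR (2 * L) by rewrite ler_pM2l // mulr_gt0.
by rewrite /H; move: hs D_; move: (ch u v) (expR _) => A B; lra.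
Qed.

(** By [pair_lower] the heights of such a steep pair differ by at least lam y2 / 4, so a horosphere
    of log-step lam / 32 separates them. The hub has exactly the height of the crossing, and only
    horizontal rounding costs. *)
Lemma good_vertical : 16 * D < (lam * y2) ^+ 2 ->
  exists l q, hdist u q + hdist q v <= hdist u v + eps / 2 * L /\
    forall z, in_Hd z -> hdist z u <= theta * L \/ hdist z v <= theta * L -> small_hub l z = q.
Proof.
move=> DV; have y1_ := y10; have y2_ := y20; have D_ := D0; have l0 := lam0; have l1 := lam1.
have gap : lam * y2 <= 4 * (y2 - y1).
  rewrite leNgt; apply/negP => h; have := pair_lower.
  have hy : 3 * y2 < 4 * y1 by nra.
  have y12 : y1 <= y2 by [].
  have sq : 16 * (y1 - y2) ^+ 2 < (lam * y2) ^+ 2 by nra.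
  have : 3 * (lam * y2) ^+ 2 < 4 * (lam ^+ 2 * (y1 * y2)).
    have -> : 3 * (lam * y2) ^+ 2 = lam ^+ 2 * y2 * (3 * y2) by ring.
    have -> : 4 * (lam ^+ 2 * (y1 * y2)) = lam ^+ 2 * y2 * (4 * y1) by ring.
    by rewrite ltr_pM2l // mulr_gt0 // exprn_gt0.
  have := sqr_ge0 (lam * y2).
  move: (lam ^+ 2 * (y1 * y2)) ((y1 - y2) ^+ 2) ((lam * y2) ^+ 2) D sq DV.
  by move=> *; lra.
pose G := y2 ^+ 2 - y1 ^+ 2.
have hG : lam * y2 ^+ 2 <= 4 * G.
  have : lam * y2 * y2 <= 4 * (y2 - y1) * (y2 + y1).
    by apply: ler_pM => //; [rewrite mulr_ge0 // ltW | exact: ltW | lra].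
  by rewrite /G; lra.
have ly0 : 0 < lam * y2 ^+ 2 by rewrite mulr_gt0 // exprn_gt0.
have G0 : 0 < G by move: hG ly0; move: (lam * _) => x; lra.
have DG : 4 * D < G.
  have : (lam * y2) ^+ 2 <= lam * y2 ^+ 2.
    by rewrite exprMn ler_wpM2r ?sqr_ge0 // expr2 ler_piMr // ltW.
  by move: DV hG; move: (_ ^+ 2) (lam * _) => x y; lra.
(* Three quarters of the way from y1^2 to y2^2: rounding down leaves Y^2 at least a quarter of the
   way up, so the crossing stays far from both ends. *)
pose Z := y1 ^+ 2 + 3 / 4 * G.
have sy1 : 0 < y1 ^+ 2 by rewrite exprn_gt0.
have Z0 : 0 < Z by rewrite /Z; move: G0 sy1; lra.
pose sig := lam / 32; have sig0 : 0 < sig by rewrite /sig divr_gt0.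
pose t := Num.floor (ln Z / 2 / sig).
have /andP[t1 t2] : sig * t%:~R <= ln Z / 2 < sig * t%:~R + sig.
  have /andP[] := floor_itv (ln Z / 2 / sig); rewrite ler_pdivlMr // ltr_pdivrMr // intrD.
  by move=> *; apply/andP; split; nra.
pose Y := ref_height t; have Y0 : 0 < Y by apply: expR_gt0.
have YE : Y ^+ 2 = expR (2 * (sig * t%:~R)).
  by rewrite expr2 /Y /ref_height -expRD; congr expR; rewrite /sig; ring.
have Yhi : Y ^+ 2 <= Z.
  by rewrite YE -[leRHS]lnK ?posrE // ler_expR; move: t1; lra.
have Ylo : y1 ^+ 2 + G / 4 <= Y ^+ 2.
  have : Z * expR (- (2 * sig)) <= Y ^+ 2.
    by rewrite YE -[X in X * _]lnK ?posrE // -expRD ler_expR; move: t2; lra.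
  apply: le_trans; have := expR_ge1Dx (- (2 * sig)); set x := expR _ => hx1.
  have : Z * (1 - lam / 16) <= Z * x by rewrite ler_pM2l //; move: hx1; rewrite /sig; lra.
  apply: le_trans; rewrite /Z; move: hG G0 l0 l1 sy1; rewrite /G.
  by move: (y1 ^+ 2) (y2 ^+ 2) => a b; nra.
have Yy1 : y1 <= Y by rewrite -(@ler_pXn2r _ 2) ?nnegrE ?ltW //; move: Ylo G0 sy1; lra.
have Yy2 : Y <= y2.
  by rewrite -(@ler_pXn2r _ 2) ?nnegrE ?ltW //; move: Yhi G0; rewrite /Z /G; lra.
have y2Y : y2 <= 2 * Y.
  rewrite -(@ler_pXn2r _ 2) ?nnegrE ?mulr_ge0 ?ltW // exprMn.
  by move: Ylo sy1; rewrite /G; lra.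
(* The quadratic in f is the squared height along the geodesic; the intermediate value theorem finds
   where it meets the horosphere. *)
have [f /andP[f0 f1] fE] : exists2 f : R, 0 <= f <= 1 & y1 ^+ 2 + (G + D) * f - D * f ^+ 2 = Y ^+ 2.
  pose p := (y1 ^+ 2 - Y ^+ 2)%:P + (G + D)%:P * 'X - D%:P * 'X ^+ 2.
  have pE x : p.[x] = y1 ^+ 2 - Y ^+ 2 + (G + D) * x - D * x ^+ 2 by rewrite /p !hornerE.
  have [|f f01 /rootP] := @poly_ivt R p 0 1 ler01.
    by rewrite !pE; apply/andP; split; move: Yhi Ylo G0; rewrite /Z; lra.
  by rewrite pE => h; exists f; [|lra].
have f5 : 1 <= 5 * f.
  have : G / 4 <= (G + D) * f by have := mulr_ge0 D_ (sqr_ge0 f); lra.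
  by move: DG G0; nra.
have f4 : 1 <= 4 * (1 - f).
  have : (1 - f) * G >= G / 4 + (1 - f) * f * D by move: Yhi; rewrite -fE /Z; lra.
  have : 0 <= (1 - f) * f * D by rewrite !mulr_ge0 // subr_ge0.
  by move: G0; nra.
have [f20 ff0 f01] := inner_facts f5 f4.
pose X j : R := (1 - f) * hx u j + f * hx v j.
pose n j := Num.floor (X j / (rho * Y)).
have rY : 0 < rho * Y by rewrite mulr_gt0.
have N0 : (0 < N)%N.
  by rewrite lt0n; apply: contraTneq NE => ->; rewrite mul0r -leNgt mulr_ge0 // ltW.
pose q : T := mkH (fun j => spacing None j * Y * (n j)%:~R) (hub_height None Y (fun=> 0%N)).
have qH : in_Hd q by apply: mkH_in.
have htq : ht q = Y by rewrite ht_mkH.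
have hxq j : hx q j = rho * Y * (n j)%:~R by rewrite hx_mkH.
have Xq j : 0 <= X j - hx q j <= rho * Y.
  by rewrite hxq; have /andP[-> /ltW ->] := floor_grid (X j) rY.
have lnp := ln_pair.
have lnY : ln Y = lam / 32 * t%:~R by rewrite expRK.
have lny : ln y1 <= ln Y <= ln y2 by rewrite !ler_ln ?posrE // Yy1 Yy2.
have f01' : 0 <= f <= 1 by rewrite f0.
have Duv j : `|hx u j - hx v j| <= lam * Y.
  apply: norm_le_sqr; first by rewrite mulr_ge0 // ltW.
  apply: le_trans (hx_dist u v j) _; rewrite -/D.
  have A : lam * y2 <= lam * (2 * Y) by rewrite ler_pM2l.
  have : (lam * y2) ^+ 2 <= (lam * (2 * Y)) ^+ 2 by apply: sqr_mono => //; rewrite mulr_ge0 ?ltW.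
  have -> : (lam * (2 * Y)) ^+ 2 = 4 * (lam * Y) ^+ 2 by ring.
  by move: DV; move: ((lam * Y) ^+ 2) (sqr_ge0 (lam * Y)) ((lam * y2) ^+ 2) => a a0 b; lra.
have rYl : rho * Y <= lam * Y by rewrite ler_pM2r.
have lY : 0 < lam * Y by rewrite mulr_gt0.
have [l lP] : exists l, forall z, in_Hd z ->
    hdist z u <= theta * L \/ hdist z v <= theta * L -> small_hub l z = q.
  apply: pair_window => //; rewrite -?lnY -/Y -/q.
  - by have [] := ln_between lny lnp L0.
  - by have [] := ln_between lny lnp L0.
  - by move: y2Y Y0; lra.
  - move=> j; have E : lam * Y + rho * Y <= 28 * lam * Y by move: rYl lY; lra.
    by have [c1 c2] := near_chord_point f01' (Duv j) (Xq j); split; [apply: le_trans c1 E | apply: le_trans c2 E].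
exists l, q; split=> //.
have W0 : 0 < lam * y2 ^+ 2 / 4 by rewrite divr_gt0.
have yE : Y ^+ 2 = (1 - f) * ht u ^+ 2 + f * ht v ^+ 2 + f * (1 - f) * dx2 u v.
  by rewrite -fE /G -/y1 -/y2 -/D; ring.
apply: le_trans (detour_le uH vH qH f01 Y0 W0 yE _) _.
  by rewrite -/y1 -/y2 -/D; apply: vertical_width.
rewrite lerD2l htq subrr expr0n addr0.
have sum : \sum_j ((1 - f) * hx u j + f * hx v j - hx q j) ^+ 2 <= m%:R * (rho * Y) ^+ 2.
  rewrite mulr_natl -[m in X in _ <= X]card_ord -sumr_const; apply: ler_sum => j _.
  by have /andP[h1 h2] := Xq j; rewrite ler_sqr ?nnegrE // ltW.
have den0 : 0 < Y * (f * (1 - f)) * (lam * y2 ^+ 2 / 4) by exact: mulr_gt0 (mulr_gt0 Y0 ff0) W0.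
rewrite (ler_pdivrMr _ _ den0).
have eL0 : 0 < eps * L * lam by rewrite !mulr_gt0.
apply: (@le_trans _ _ (Y * (eps * L * lam / 1024 * Y ^+ 2))).
  rewrite ler_pM2l //; apply: le_trans sum _; rewrite exprMn mulrA ler_wpM2r ?sqr_ge0 //.
  by move: rhoE; lra.
have -> : eps / 2 * L * (Y * (f * (1 - f)) * (lam * y2 ^+ 2 / 4)) =
   Y * (eps * L * lam / 8 * (f * (1 - f) * y2 ^+ 2)) by field.
rewrite ler_pM2l //.
have : 20^-1 * Y ^+ 2 <= f * (1 - f) * y2 ^+ 2.
  by apply: ler_pM; rewrite ?invr_ge0 ?sqr_ge0 // ler_sqr ?nnegrE // ltW.
by move: eL0 (sqr_ge0 Y); move: (eps * L * lam) (Y ^+ 2) (f * (1 - f) * _) => a b x; nra.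
Qed.
(** The largest of [m] squared displacements is at least their mean. *)
Lemma long_axis : exists i, D <= m%:R * (hx u i - hx v i) ^+ 2.
Proof.
apply: contrapT => h.
have lt i : 0 < D - m%:R * (hx u i - hx v i) ^+ 2.
  by rewrite subr_gt0 ltNge; apply/negP => hi; apply: h; exists i.
have : \sum_i (D - m%:R * (hx u i - hx v i) ^+ 2) == 0.
  rewrite sumrB sumr_const card_ord -mulr_sumr -[\sum_(i < m) _]/(dx2 u v) -/D.
  by rewrite mulr_natl subrr.
rewrite psumr_eq0; last by move=> i _; apply: ltW.
move=> /allP /(_ (Ordinal m0) (mem_index_enum _)) /=.
by rewrite gt_eqF.
Qed.

(** The hyperplane fixes one horizontal coordinate exactly, but leaves the height of the crossing
    free. Over the middle half of the chord the log-height varies by O(lam) around the value that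
    the reference height rounds, so a fine label has room for it. *)
Lemma good_horizontal : (lam * y2) ^+ 2 <= 16 * D ->
  exists l q, hdist u q + hdist q v <= hdist u v + eps / 2 * L /\
    forall z, in_Hd z -> hdist z u <= theta * L \/ hdist z v <= theta * L -> small_hub l z = q.
Proof.
move=> DH; have y1_ := y10; have y2_ := y20; have D_ := D0; have l0 := lam0; have l1 := lam1.
have m_1 := mR; have y12 : y1 <= y2 by [].
have sy1 : 0 < y1 ^+ 2 by rewrite exprn_gt0.
have sy2 : 0 < y2 ^+ 2 by rewrite exprn_gt0.
have sl0 : 0 < lam ^+ 2 by rewrite exprn_gt0.
have sl1 : lam ^+ 2 <= 1 by rewrite expr_le1 // ltW.
have Dp : 0 < D.
  by have : 0 < (lam * y2) ^+ 2 by [rewrite exprn_gt0 // mulr_gt0]; move: DH; lra.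
have DH' : lam ^+ 2 * y2 ^+ 2 <= 16 * D by rewrite -exprMn.
pose H := (y1 ^+ 2 + y2 ^+ 2) / 2 + D / 4.
have H0 : 0 < H by rewrite /H; lra.
pose y0 := Num.sqrt H.
have y0p : 0 < y0 by rewrite sqrtr_gt0.
have y0E : y0 ^+ 2 = H by rewrite sqr_sqrtr // ltW.
pose sig := lam / 32; have sig0 : 0 < sig by rewrite /sig divr_gt0.
pose t := Num.floor (ln y0 / sig).
have /andP[t1 t2] : 0 <= ln y0 - sig * t%:~R < sig := floor_grid (ln y0) sig0.
pose Y := ref_height t; have Y0 : 0 < Y by apply: expR_gt0.
have lnY : ln Y = sig * t%:~R by rewrite expRK.
have Yy0 : Y <= y0 by rewrite -(lnK (y0p : y0 \is Num.pos)) ler_expR -/sig; lra.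
have y0Y : y0 <= 21 / 20 * Y.
  have : y0 * expR (- sig) <= Y.
    by rewrite -{1}(lnK (y0p : y0 \is Num.pos)) -expRD ler_expR -/sig; lra.
  have := expR_ge1Dx (- sig); have : sig <= 32^-1 by rewrite /sig; lra.
  by move: (expR _) y0p => x; nra.
have HY : H <= 10 / 9 * Y ^+ 2.
  rewrite -y0E; apply: (@le_trans _ _ ((21 / 20 * Y) ^+ 2)).
    by apply: sqr_mono => //; exact: ltW.
  by have := sqr_ge0 Y; rewrite exprMn; move: (Y ^+ 2) => Y2; lra.
have YH : Y ^+ 2 <= H by rewrite -y0E; apply: sqr_mono => //; exact: ltW.
have DY : D <= (12 * lam * Y) ^+ 2.
  have -> : (12 * lam * Y) ^+ 2 = 144 * (lam ^+ 2 * Y ^+ 2) by ring.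
  case: lamE => -[lE hL].
    have := pair_upper lE; have -> : (8 * lam * y2) ^+ 2 = 64 * (lam ^+ 2 * y2 ^+ 2) by ring.
    have : lam ^+ 2 * y2 ^+ 2 <= lam ^+ 2 * (2 * (10 / 9 * Y ^+ 2)).
      by rewrite ler_pM2l //; move: HY; rewrite /H; lra.
    by have := sqr_ge0 (y1 - y2); move: (lam ^+ 2) (Y ^+ 2) ((y1 - y2) ^+ 2) => a b e; lra.
  by rewrite lE expr1n; move: HY (sqr_ge0 Y); rewrite /H; move: (Y ^+ 2) => Y2; lra.
have y2Y : y2 <= 3 * Y.
  rewrite -(@ler_pXn2r _ 2) ?nnegrE ?mulr_ge0 ?ltW // exprMn.
  by move: HY; rewrite /H; lra.
have [i iP] := long_axis.
pose s := sigc * Y; have s0 : 0 < s by rewrite mulr_gt0.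
have [n_i [f [/andP[f1 f2] fE]]] : exists (n : int) (f : R),
    4^-1 <= f <= 3 / 4 /\ hx u i + f * (hx v i - hx u i) = s * n%:~R.
  apply: plane_crossing => //; rewrite -[2 * s]ger0_norm; last by rewrite mulr_ge0 // ltW.
  rewrite -ler_sqr ?nnegrE // !real_normK ?num_real // -(@ler_pM2l _ m%:R); last by lra.
  have -> : (hx v i - hx u i) ^+ 2 = (hx u i - hx v i) ^+ 2 by ring.
  apply: le_trans iP.
  have -> : m%:R * (2 * s) ^+ 2 = (lam ^+ 2 * Y ^+ 2 / 25) / m%:R.
    by rewrite /s /sigc; field; rewrite gt_eqF //; lra.
  rewrite ler_pdivrMr; last by lra.
  have : lam ^+ 2 * Y ^+ 2 <= lam ^+ 2 * H by rewrite ler_pM2l.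
  have : lam ^+ 2 * H <= 17 * D.
    have : lam ^+ 2 * y1 ^+ 2 <= lam ^+ 2 * y2 ^+ 2 by rewrite ler_pM2l //; apply: sqr_mono => //; exact: ltW.
    have : lam ^+ 2 * D <= D by rewrite ler_piMl.
    by rewrite /H; move: (y1 ^+ 2) (y2 ^+ 2) (lam ^+ 2) DH' => a b e; lra.
  have : D <= D * m%:R by rewrite ler_peMr.
  by move: (lam ^+ 2 * Y ^+ 2) (lam ^+ 2 * H) (D * _) => a b e; lra.
have [f0p f1p f01 f01'] := middle_facts f1 f2.
pose F := (1 - f) * y1 ^+ 2 + f * y2 ^+ 2 + f * (1 - f) * D.
have F0 : 0 < F.
  have a1 : 0 < (1 - f) * y1 ^+ 2 by rewrite mulr_gt0.
  have a2 : 0 < f * y2 ^+ 2 by rewrite mulr_gt0.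
  have a3 : 0 < f * (1 - f) * D by rewrite !mulr_gt0.
  by rewrite /F; lra.
have FH : H / 2 <= F <= 3 / 2 * H /\ (1 - 16 * lam) * H <= F <= (1 + 16 * lam) * H.
  apply: chord_height => //; first by rewrite f1.
  by case: lamE => -[lE _]; [left; apply: pair_upper | right].
have [/andP[FH1 FH2] /andP[FH3 FH4]] := FH.
pose ym := Num.sqrt F.
have ymp : 0 < ym by rewrite sqrtr_gt0.
have ymE : ym ^+ 2 = F by rewrite sqr_sqrtr // ltW.
have lnym : ln y0 - 16 * lam <= ln ym <= ln y0 + 16 * lam.
  by apply: ln_close => //; rewrite ymE y0E.
pose a := (ln ym - sig * t%:~R + 17 * lam) / rho.
have sigl : sig <= lam by rewrite /sig ler_piMr ?invf_le1 ?ler1n // ltW.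
have [a0 aN] := fine_label l0 rho0 lnym t1 (ltW t2) sigl.
pose k := Num.truncn a.
have /andP[k1 k2] := truncn_itv a0.
have kN : (k < N)%N.
  rewrite -(ltr_nat R); apply: le_lt_trans k1 _; rewrite -(ltr_pM2r rho0).
  exact: le_lt_trans aN NE.
pose X j : R := (1 - f) * hx u j + f * hx v j.
pose n j := if j == i then n_i else Num.floor (X j / (rho * Y)).
have rY : 0 < rho * Y by rewrite mulr_gt0.
pose q : T := mkH (fun j => spacing (Some i) j * Y * (n j)%:~R) (hub_height (Some i) Y (fun=> k)).
have hq0 : 0 < hub_height (Some i) Y (fun=> k) by apply: hub_height_gt0.
have qH : in_Hd q by apply: mkH_in.
have htq : ht q = Y * expR (rho * k%:R - 17 * lam) by rewrite ht_mkH.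
have Xq j : 0 <= X j - hx q j <= rho * Y.
  rewrite hx_mkH // /n /spacing; have [->|ji] := eqVneq j i.
    rewrite eqxx -/Y -/s -fE.
    have -> : X i - (hx u i + f * (hx v i - hx u i)) = 0 by rewrite /X; ring.
    by rewrite lexx ltW.
  have -> : (Some i == Some j) = false by apply/eqP => -[ij]; rewrite ij eqxx in ji.
  by rewrite -/Y; have /andP[-> /ltW ->] := floor_grid (X j) rY.
have lnp := ln_pair; have lamL_ := lamL.
have lnH : ln H = 2 * ln y0 by rewrite -y0E lnXn // mulr2n; ring.
have /andP[d1 d2] : ln y1 + ln y2 <= ln H <= ln y1 + ln y2 + 2 * L := ln_mid_height.
rewrite lnH in d1 d2.
have lny12 : ln y1 <= ln y2 by rewrite ler_ln ?posrE.
have sigL : sig <= L / 32 by apply: ler_wpM2r => //; rewrite invr_ge0.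
have Duv j : `|hx u j - hx v j| <= 12 * lam * Y.
  apply: norm_le_sqr; first by rewrite !mulr_ge0 // ltW.
  by apply: le_trans (hx_dist u v j) _.
have rYl : rho * Y <= lam * Y by rewrite ler_pM2r.
have lY : 0 < lam * Y by rewrite mulr_gt0.
have [l lP] : exists l, forall z, in_Hd z ->
    hdist z u <= theta * L \/ hdist z v <= theta * L -> small_hub l z = q.
  apply: pair_window => //; rewrite -/sig -/Y -/q.
  - by have [] := ln_window d1 d2 lnp t1 (ltW t2) sigL lny12 L0.
  - by have [] := ln_window d1 d2 lnp t1 (ltW t2) sigL lny12 L0.
  - move=> j; have E := window_sum (ltW lY) rYl.
    by have [c1 c2] := near_chord_point f01' (Duv j) (Xq j); split; [apply: le_trans c1 E | apply: le_trans c2 E].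
exists l, q; split=> //.
have W0 : 0 < lam * F / 7 by rewrite divr_gt0 // mulr_gt0.
have yE : ym ^+ 2 = (1 - f) * ht u ^+ 2 + f * ht v ^+ 2 + f * (1 - f) * dx2 u v by rewrite ymE.
have [rho_0 rho_1] : 0 < rho /\ rho <= 1 by split=> //; apply: le_trans rhol l1.
set yq := ht q in htq.
have yq0 : 0 < yq by rewrite htq.
have aE : a * rho = ln ym - sig * t%:~R + 17 * lam by rewrite /a divfK // gt_eqF.
have k1' : k%:R * rho <= a * rho by rewrite ler_pM2r.
have k2' : a * rho < k.+1%:R * rho by rewrite ltr_pM2r.
have aE' := aE.
have yqE : yq = expR (sig * t%:~R + (rho * k%:R - 17 * lam)) by rewrite htq [RHS]expRD.
have [b1 b2] := rounding_bounds aE' k1' k2'.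
have [yqm ym4 ymr] := height_rounding ymp rho_0 rho_1 b1 b2; rewrite -yqE in yqm ym4 ymr.
apply: le_trans (detour_le uH vH qH f01 ymp W0 yE _) _.
  by rewrite -/y1 -/y2 -/D; apply: chord_width => //; exact: ltW.
rewrite lerD2l -/yq.
have sum : \sum_j ((1 - f) * hx u j + f * hx v j - hx q j) ^+ 2 <= m%:R * (rho * Y) ^+ 2.
  rewrite mulr_natl -[m in X in _ <= X]card_ord -sumr_const; apply: ler_sum => j _.
  by have /andP[h1 h2] := Xq j; apply: sqr_mono.
have -> : eps / 2 * L = eps * L / 2 by ring.
have f12 : 4^-1 <= f <= 3 / 4 by rewrite f1.
have eL0 : 0 < eps * L by rewrite mulr_gt0.
have sr0 : 0 < rho ^+ 2 by rewrite exprn_gt0.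
apply: (@chord_excess _ ym yq f lam (eps * L) _ F m%:R (rho ^+ 2)) => //.
apply: lerD.
  apply: le_trans sum _.
  have -> : m%:R * (rho * Y) ^+ 2 = m%:R * rho ^+ 2 * Y ^+ 2 by ring.
  by apply: ler_wpM2l; [rewrite mulr_ge0 // ltW | apply: le_trans YH _; rewrite mulrC -ler_pdivrMr].
by rewrite -ymE -exprMn; apply: sqr_mono => //; rewrite subr_ge0.
Qed.

End Pair.

Lemma hub_family_small : hub_family m eps theta L (m.+1 * M * (1000 * m) * N ^ m)%:R.
Proof.
have card_l : #|small_label| = (m.+1 * M * (1000 * m) * N ^ m)%N.
  by rewrite !card_prod card_option card_ffun !card_ord.
exists small_label, small_hub; split; [by rewrite card_l | exact: small_hub_in |].
move=> u v uH vH /andP[Ld dL].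
have ordered a b : in_Hd a -> in_Hd b -> ht a <= ht b -> L <= hdist a b -> hdist a b < 2 * L ->
    exists l q, hdist a q + hdist q b <= hdist a b + eps / 2 * L /\
    forall z, in_Hd z -> hdist z a <= theta * L \/ hdist z b <= theta * L -> small_hub l z = q.
  move=> aH bH ab Lab abL.
  have [h|h] := leP ((lam * ht b) ^+ 2) (16 * dx2 a b); first exact: good_horizontal.
  exact: good_vertical.
have [uv|/ltW vu] := leP (ht u) (ht v); first exact: ordered.
have [|||||l [q [ex near]]] := ordered v u => //; rewrite ?(hdistC vH uH) //.
have qH : in_Hd q.
  have -> : q = small_hub l v; last exact: small_hub_in.
  by symmetry; apply: near => //; left; rewrite hdistxx // mulr_ge0 // ltW.
exists l, q; split; last by move=> z zH zz; apply: near => //; case: zz; [right | left].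
by move: ex; rewrite (hdistC vH qH) (hdistC qH uH) (hdistC vH uH) addrC.
Qed.

End SmallScale.

(** * Counting *)

Lemma hub_family_le (R : realType) m (eps theta L K K' : R) :
  K <= K' -> hub_family m eps theta L K -> hub_family m eps theta L K'.
Proof. by move=> KK' [F [f [cF h1 h2]]]; exists F, f; split=> //; apply: le_trans KK'. Qed.

Lemma hub_family_nat (R : realType) m (eps theta L K : R) : hub_family m eps theta L K ->
  exists g : nat -> hpoint R m.+1 -> hpoint R m.+1,
    (forall k z, in_Hd (g k z)) /\
    forall u v, in_Hd u -> in_Hd v -> L <= hdist u v < 2 * L ->
     exists k q, [/\ (k < Num.truncn K)%N, hdist u q + hdist q v <= hdist u v + eps / 2 * L &
       forall z, in_Hd z -> hdist z u <= theta * L \/ hdist z v <= theta * L -> g k z = q].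
Proof.
move=> [F [f [cF fH good]]].
have cF' : (#|F| <= Num.truncn K)%N.
  by rewrite truncn_ge_nat //; apply: le_trans cF.
(* Numbers beyond the family get a fixed point, which keeps [in_Hd] valid for all of them. *)
exists (fun k z => if insub k is Some i then f (enum_val (i : 'I_#|F|)) z
                   else mkH (fun=> 0) 1); split.
  by move=> k z; case: (insub k) => [i|]; [exact: fH | exact: mkH_in].
move=> u v uH vH uv; have [l [q [ex near]]] := good u v uH vH uv.
exists (enum_rank l), q; split=> //; first exact: leq_trans (ltn_ord _) cF'.
by move=> z zH zz; rewrite valK enum_rankK; apply: near.
Qed.

(* With w = lam / rho, the number of labels is of order w ^ m * L', where L' = max (1, L);
   this is w ^ 2 * L' = O (m / eps) times w ^ (m - 2). *)
Lemma label_count (R : realType) (m : nat) (eps s w L' : R) : (0 < m)%N -> 0 < eps ->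
  0 < s -> s ^+ 2 = eps -> 1 <= w -> 1 <= L' -> w ^+ 2 * L' = 1024 * m%:R / eps ->
  m.+1%:R * (1000 * m%:R) * ((257 * L') * (81 ^+ m * w ^+ m)) <=
  (if (2 <= m)%N then m.+1%:R * (1000 * m%:R) * 257 * 2592 ^+ m * m%:R ^+ m * s^-1 ^+ m
   else 2 * 1000 * 257 * 81 * 1024 / eps).
Proof.
case: m => [//|[_|m _]] e0 s0 sE w1 L1 wE.
  (* With one horizontal axis only w L' is to be bounded, and w <= w^2 gives 1 / eps. This is the
     exceptional exponent for d = 2. *)
  rewrite /= !expr1; have : w * L' <= 1024 / eps.
    have <- : w ^+ 2 * L' = 1024 / eps by rewrite wE mulr1.
    by rewrite expr2 -mulrA; apply: ler_peMl => //; nra.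
  by move: (eps^-1) => z; lra.
rewrite /=; have w0 : 0 < w by lra.
have ie0 : 0 < eps^-1 by rewrite invr_gt0.
have is0 : 0 < s^-1 by rewrite invr_gt0.
have seE : s^-1 ^+ 2 = eps^-1 by rewrite exprVn sE.
set n := m.+2%:R in wE *; have n1 : 1 <= n by rewrite ler1n.
have nsE : 1024 * n / eps <= (32 * n * s^-1) ^+ 2.
  have -> : (32 * n * s^-1) ^+ 2 = 1024 * n ^+ 2 * s^-1 ^+ 2 by ring.
  by rewrite seE ler_pM2r // ler_pM2l // expr2 ler_peMr //; lra.
have wx : w <= 32 * n * s^-1.
  rewrite -(@ler_pXn2r _ 2) ?nnegrE ?(ltW w0) //; last by rewrite !mulr_ge0 ?(ltW is0) //; lra.
  by apply: le_trans nsE; rewrite -wE ler_peMr // sqr_ge0.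
have wm : w ^+ m.+2 * L' <= 32 ^+ m.+2 * n ^+ m.+2 * s^-1 ^+ m.+2.
  rewrite -!exprMn -(addn2 m) !exprD.
  have -> : w ^+ m * w ^+ 2 * L' = w ^+ m * (w ^+ 2 * L') by ring.
  apply: ler_pM; last by rewrite wE.
  - by rewrite exprn_ge0 // ltW.
  - exact: mulr_ge0 (sqr_ge0 w) (le_trans ler01 L1).
  - by apply: lerXn2r; rewrite ?nnegrE // ?(ltW w0) // (le_trans (ltW w0) wx).
have -> : 2592 ^+ m.+2 = 81 ^+ m.+2 * 32 ^+ m.+2 :> R by rewrite -exprMn; congr (_ ^+ _); lra.
have C0 : 0 <= m.+3%:R * (1000 * n) * 257 * 81 ^+ m.+2.
  have n0 : 0 <= n by lra.
  have a1 : 0 <= 1000 * n by lra.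
  have a2 : 0 <= m.+3%:R * (1000 * n) := mulr_ge0 (ler0n R _) a1.
  have a3 : 0 <= 81 ^+ m.+2 :> R by apply: exprn_ge0.
  by apply: mulr_ge0 a3; move: a2; lra.
have -> : m.+3%:R * (1000 * n) * (257 * L' * (81 ^+ m.+2 * w ^+ m.+2)) =
   m.+3%:R * (1000 * n) * 257 * 81 ^+ m.+2 * (w ^+ m.+2 * L') by ring.
have -> : m.+3%:R * (1000 * n) * 257 * (81 ^+ m.+2 * 32 ^+ m.+2) * n ^+ m.+2 * s^-1 ^+ m.+2 =
   m.+3%:R * (1000 * n) * 257 * 81 ^+ m.+2 * (32 ^+ m.+2 * n ^+ m.+2 * s^-1 ^+ m.+2) by ring.
exact: ler_wpM2l.
Qed.

Lemma round_up (R : realType) (c : nat) (x : R) : 1 <= x ->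
  exists2 M : nat, c%:R * x < M%:R & M%:R <= c.+1%:R * x.
Proof.
move=> x1; have a : 0 <= c%:R * x by rewrite mulr_ge0 // (le_trans ler01).
have /andP[M1 M2] := truncn_itv a.
by exists (Num.truncn (c%:R * x)).+1 => //; rewrite -!natr1 mulrDl mul1r lerD.
Qed.

Section Count.
Variables (R : realType) (m : nat) (eps : R).
Hypotheses (m0 : (0 < m)%N) (e0 : 0 < eps) (e1 : eps <= 1).
(** Scales with eps L below 40 (m + 1) then satisfy theta L <= 1; the others fall under
    [hub_family_large]. *)
Let theta := eps / (40 * m.+1%:R).

Lemma hub_family_exists (L : R) : 0 < L ->
  hub_family m eps theta L
    (if (2 <= m)%N then m.+1%:R * (1000 * m%:R) * 257 * 2592 ^+ m * m%:R ^+ m * (Num.sqrt eps)^-1 ^+ m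
     else 2 * 1000 * 257 * 81 * 1024 / eps).
Proof.
move=> L0; have eps0 := e0; have eps1 := e1.
have mR : 1 <= m%:R :> R by rewrite ler1n.
have m1R : m.+1%:R = m%:R + 1 :> R by rewrite -natr1.
have d0 : 0 < 40 * m.+1%:R :> R by rewrite m1R; lra.
have thE : theta * (40 * m.+1%:R) = eps by rewrite /theta divfK // gt_eqF.
have th0 : 0 < theta by rewrite divr_gt0.
pose s := Num.sqrt eps; have s0 : 0 < s by rewrite sqrtr_gt0.
have sE : s ^+ 2 = eps by rewrite sqr_sqrtr // ltW.
have s1 : 1 <= s^-1.
  by rewrite invf_ge1 // -(@ler_pXn2r _ 2) ?nnegrE ?(ltW s0) // expr1n sE.
have seE : s^-1 ^+ 2 = eps^-1 by rewrite exprVn sE.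
have e1' : 1 <= eps^-1 by rewrite invf_ge1.
have [eL|eL] := leP (40 * m.+1%:R) (eps * L).
  have e01 : 0 < eps <= 1 by rewrite e0.
  have t16 : 16 * theta <= eps by rewrite -thE m1R; nra.
  apply: hub_family_le (hub_family_large e01 t16 eL).
  case: ifPn => m2; last first.
    have -> : m = 1%N by apply/eqP; rewrite eqn_leq m0 andbT leqNgt.
    by rewrite expr1; lra.
  have x1 : eps^-1 <= s^-1 ^+ m by rewrite -seE ler_weXn2l.
  have x2 : 16 ^+ m <= 2592 ^+ m :> R by apply: lerXn2r; rewrite ?nnegrE; lra.
  have x3 : 1 <= m%:R ^+ m :> R by rewrite exprn_ege1.
  have x4 : 97 <= m.+1%:R * (1000 * m%:R) * 257 :> R by rewrite m1R; nra.
  have -> : 97 / eps * 16 ^+ m = 97 * 16 ^+ m * 1 * eps^-1 by ring.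
  have p16 : 0 <= 16 ^+ m :> R by rewrite exprn_ge0.
  by do 3 (apply: ler_pM => //; rewrite ?mulr_ge0 ?invr_ge0 ?(ltW e0) //).
have [lam [lamE lam0 lam1 lamL]] : exists lam : R,
    [/\ lam = L /\ L <= 1 \/ lam = 1 /\ 1 <= L, 0 < lam, lam <= 1 & lam <= L].
  by have [h|h] := leP L 1; [exists L; split=> //; left | exists 1; split=> //; [right; split=> // | ]; exact: ltW].
pose r2 := eps * L * lam / (1024 * m%:R).
have mp : 0 < 1024 * m%:R :> R by lra.
have r20 : 0 < r2 by rewrite divr_gt0 // !mulr_gt0.
pose rho := Num.sqrt r2; have rho0 : 0 < rho by rewrite sqrtr_gt0.
have rhoE : rho ^+ 2 = r2 by rewrite sqr_sqrtr // ltW.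
have rhoE' : 1024 * m%:R * rho ^+ 2 = eps * L * lam by rewrite rhoE /r2 mulrC divfK // gt_eqF.
have rhol : rho <= lam.
  rewrite -(@ler_pXn2r _ 2) ?nnegrE ?(ltW rho0) ?(ltW lam0) // rhoE /r2 ler_pdivrMr //.
  have -> : lam ^+ 2 * (1024 * m%:R) = lam * (1024 * m%:R) * lam by ring.
  rewrite ler_pM2r //; case: lamE => -[-> h]; first by rewrite mulrC ler_pM2l //; lra.
  by apply: le_trans (ltW eL) _; rewrite m1R; lra.
pose w := lam / rho; have w1 : 1 <= w by rewrite /w ler_pdivlMr // mul1r.
have w0 : 0 < w by rewrite divr_gt0.
pose L' := L / lam; have L1 : 1 <= L' by rewrite /L' ler_pdivlMr // mul1r.
have wE : w ^+ 2 * L' = 1024 * m%:R / eps.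
  rewrite /w exprMn exprVn rhoE /r2 /L'; field; rewrite !gt_eqF //; lra.
have [M M2 Mle] := round_up 256 L1; have [N N2 Nle] := round_up 80 w1.
have ME : 256 * L < M%:R * lam.
  by rewrite -ltr_pdivrMr //; have -> : 256 * L / lam = 256 * L' by rewrite /L'; ring.
have NE : 80 * lam < N%:R * rho.
  by rewrite -ltr_pdivrMr //; have -> : 80 * lam / rho = 80 * w by rewrite /w; ring.
have thL : theta * L <= 1.
  rewrite -(ler_pM2l d0) mulr1; apply: le_trans (ltW eL).
  have -> : 40 * m.+1%:R * (theta * L) = theta * (40 * m.+1%:R) * L by ring.
  by rewrite thE.
have th1 : theta <= 1 by rewrite -(ler_pM2l d0) mulrC thE mulr1 (le_trans eps1) // -natrM ler1n.
have rhoE2 : 1024 * m%:R * rho ^+ 2 <= eps * L * lam by rewrite rhoE'.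
apply: hub_family_le (hub_family_small m0 e0 (ltW th0) th1 thL L0 lamE rho0 rhol rhoE2 ME NE).
rewrite !natrM natrX.
have Nm : N%:R ^+ m <= 81 ^+ m * w ^+ m by rewrite -exprMn; apply: lerXn2r; rewrite // nnegrE // mulr_ge0 // ltW.
have C0 : 0 <= m.+1%:R * (1000 * m%:R) :> R by rewrite !mulr_ge0.
apply: (@le_trans _ _ (m.+1%:R * (1000 * m%:R) * ((257 * L') * (81 ^+ m * w ^+ m)))).
  have -> : m.+1%:R * M%:R * (1000 * m%:R) * N%:R ^+ m = m.+1%:R * (1000 * m%:R) * (M%:R * N%:R ^+ m) :> R by ring.
  by apply: ler_wpM2l => //; apply: ler_pM => //; rewrite exprn_ge0.
exact: (label_count m0 e0 s0 sE w1 L1 wE).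
Qed.

End Count.

(** * Final constants *)

Lemma scale_slack (R : realType) (x : R) : x <= 1 -> 6 * x + 10 <= 2048 / 40.
Proof. by lra. Qed.

(** As d >= 3, every numerical constant is below a power of 3, hence of d; the exponents add up to 9
    m + 20 <= 20 (m + 1). *)
Lemma dimension_factor (m : nat) : (2 <= m)%N ->
  (8 * (m + 12) * m.+1 * 1000 * m * 257 * 2592 ^ m * m ^ m <= m.+1 ^ (20 * m.+1))%N.
Proof.
move=> m2; set d := m.+1; have d3 : (3 <= d)%N by [].
have pow k j : (k <= 3 ^ j)%N -> (k <= d ^ j)%N.
  by move=> h; apply: leq_trans h _; case: j => // j; rewrite leq_exp2r.
have h12 : (m + 12 <= d ^ 3)%N.
  apply: (@leq_trans (9 * d)); first by rewrite /d; lia.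
  by rewrite (expnSr d 2) leq_mul2r (pow 9 2)%N // orbT.
have md : (m <= d)%N by [].
have hm : (m ^ m <= d ^ m)%N by rewrite leq_exp2r // ltnW.
have h2592 : (2592 ^ m <= d ^ (8 * m))%N by rewrite expnM leq_exp2r ?pow // ltnW.
apply: (@leq_trans (d ^ 2 * d ^ 3 * d ^ 1 * d ^ 7 * d ^ 1 * d ^ 6 * d ^ (8 * m) * d ^ m)).
  by do !apply: leq_mul => //; rewrite ?expn1 //; apply: pow.
by rewrite -!expnD leq_exp2l // /d; lia.
Qed.

(** Take 2^e >= 1 / eps and J = e (m + 12), using 2^(m + 11) >= 2048 (m + 1). The product form keeps
    ln (1 / eps) as a factor, and eps <= 1/2 gives ln (1 / eps) >= 1/2, which absorbs the rounding
    of e. *)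
Lemma number_of_scales (R : realType) (m : nat) (eps : R) : 0 < eps <= 2^-1 ->
  exists J, [/\ (0 < J)%N, 6 * (eps / (40 * m.+1%:R)) + 10 <= 2 ^+ J * (eps / (40 * m.+1%:R)) &
     J%:R <= 4 * (m + 12)%:R * ln eps^-1].
Proof.
move=> /andP[e0 e2]; have eps1 : eps <= 1 by lra.
have e02 : expR (2^-1 : R) <= 2.
  have := expR_ge1Dx (- 2^-1 : R); have := expR_gt0 (2^-1 : R).
  have := expRxMexpNx_1 (2^-1 : R); move: (expR _) (expR _) => x y; nra.
have ie0 : 0 < eps^-1 by rewrite invr_gt0.
have ie2 : 2 <= eps^-1 by rewrite -[leLHS]invrK lef_pV2 ?posrE // invr_gt0.
have ln_half : 2^-1 <= ln eps^-1.
  by rewrite -(expRK (2^-1)) ler_ln ?posrE ?expR_gt0 // (le_trans e02).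
set l := ln eps^-1 in ln_half *.
have l20 : 0 <= 2 * l by lra.
pose e := (Num.truncn (2 * l)).+1.
have /andP[t1 t2] := truncn_itv l20.
have el : e%:R <= 4 * l by rewrite /e -natr1; lra.
have pe : eps^-1 <= 2 ^+ e.
  rewrite -(lnK (ie0 : eps^-1 \is Num.pos)) -/l.
  apply: (@le_trans _ _ (expR (2^-1) ^+ e)).
    by rewrite -expRM_natr ler_expR; move: t2; rewrite -/e; lra.
  by apply: lerXn2r; rewrite ?nnegrE ?expR_ge0.
exists (e * (m + 12))%N; split.
- by rewrite muln_gt0 addn_gt0 orbT.
- have d0 : 0 < 40 * m.+1%:R :> R by rewrite mulr_gt0.
  set D := 40 * m.+1%:R in d0 *.
  have big : 2 ^+ e * (2048 * m.+1%:R) <= 2 ^+ (e * (m + 12)) :> R.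
    rewrite -!natrX -!natrM ler_nat.
    apply: (@leq_trans (2 ^ (e + (m + 11)))); last first.
      by rewrite leq_exp2l // (addnS m 11) mulnS leq_add2l leq_pmull.
    rewrite [(2 ^ (e + _))%N]expnD leq_mul2l; apply/orP; right.
    rewrite expnD mulnC leq_mul //; exact: ltn_expl.
  have : eps^-1 * (2048 * m.+1%:R) <= 2 ^+ (e * (m + 12)).
    by apply: le_trans big; rewrite ler_wpM2r // mulr_ge0.
  move=> hB; apply: (@le_trans _ _ (eps^-1 * (2048 * m.+1%:R) * (eps / D))); last first.
    by rewrite ler_wpM2r // divr_ge0 // ltW.
  have -> : eps^-1 * (2048 * m.+1%:R) * (eps / D) = 2048 / 40.
    by rewrite /D; field; rewrite (gt_eqF e0) /= addrC natr1 pnatr_eq0.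
  have D1 : 1 <= D by rewrite /D -natrM ler1n.
  by apply: scale_slack; rewrite ler_pdivrMr // mul1r (le_trans eps1).
- rewrite natrM mulrAC; apply: ler_wpM2r => //.
Qed.

Theorem mainTheorem12 :
  exists C : nat, forall (R : realType) (d : nat) (eps : R) (P : seq (hpoint R d)),
    (2 <= d)%N -> 0 < eps <= 2^-1 -> uniq P -> all (@in_Hd R d) P ->
    exists (Q : seq (hpoint R d)) (E : seq (hpoint R d * hpoint R d)),
      bipartite_steiner_spanner (1 + eps) P Q E /\
      forall p, p \in P ->
        (degree E p)%:R <=
          (if (3 <= d)%N
           then (d ^ (C * d))%:R * eps `^ ((1 - d%:R) / 2) * ln eps^-1
           else C%:R * eps^-1 * ln eps^-1).
Proof.
have [C [C20 Cbig]] : exists C : nat, (20 <= C)%N /\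
    forall R : realType, 8 * 13 * (2 * 1000 * 257 * 81 * 1024) <= C%:R :> R.
  (* 20 is the exponent from [dimension_factor]; the constant for d = 2 is about 4.4 times 10^12. *)
  exists (20 + 10 ^ 13)%N; split; first exact: leq_addr.
  by move=> R; rewrite natrD natrX; lra.
exists C => R [//|m] eps P m1 epsP _ PH.
have m0 : (0 < m)%N by [].
have /andP[e0 e2] := epsP; have e1 : eps <= 1 by lra.
have [J [J0 JB Jl]] := number_of_scales m epsP.
set theta := eps / (40 * m.+1%:R) in JB.
have d0 : 0 < 40 * m.+1%:R :> R by rewrite mulr_gt0.
have th0 : 0 < theta by rewrite divr_gt0.
have teps : 12 * theta <= eps.
  have mR : 1 <= m.+1%:R :> R by rewrite ler1n.
  rewrite -[leRHS](divfK (lt0r_neq0 d0)) -/theta; nra.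
set K : R := (if (2 <= m)%N
  then m.+1%:R * (1000 * m%:R) * 257 * 2592 ^+ m * m%:R ^+ m * (Num.sqrt eps)^-1 ^+ m
  else 2 * 1000 * 257 * 81 * 1024 / eps).
have hubs L : exists g : nat -> hpoint R m.+1 -> hpoint R m.+1,
    (forall k z, in_Hd (g k z)) /\
    (0 < L -> forall u v, in_Hd u -> in_Hd v -> L <= hdist u v < 2 * L ->
     exists k q, [/\ (k < Num.truncn K)%N, hdist u q + hdist q v <= hdist u v + eps / 2 * L &
       forall z, in_Hd z -> hdist z u <= theta * L \/ hdist z v <= theta * L -> g k z = q]).
  have [L0|L0] := ltP 0 L; last first.
    by exists (fun _ _ => mkH (fun=> 0) 1); split=> // k z; apply: mkH_in.
  have [g [gH good]] := hub_family_nat (hub_family_exists m0 e0 e1 L0).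
  by exists g; split.
have /choice[G GP] := hubs.
have [||Q [E [span deg]]] := @spanner_of_hubs R m eps theta P (Num.truncn K) J G PH th0 teps e1 J0 JB.
- by move=> L k z; have [h _] := GP L; apply: h.
- by move=> L u v L0; have [_ h] := GP L; apply: h.
exists Q, E; split=> // p pP.
have s0 : 0 < Num.sqrt eps by rewrite sqrtr_gt0.
have K0 : 0 <= K.
  rewrite /K; case: ifP => _; last by apply: divr_ge0; rewrite ?mulr_ge0 // ltW.
  by rewrite !mulr_ge0 ?exprn_ge0 ?invr_ge0 // ltW.
have l0 : 0 <= ln eps^-1 by apply: ln_ge0; rewrite invf_ge1.
have degK : (degree E p)%:R <= 8 * (m + 12)%:R * K * ln eps^-1.
  apply: (@le_trans _ _ (2 * J * Num.truncn K)%:R); first by rewrite ler_nat deg.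
  rewrite !natrM; have Kt := truncn_le K; rewrite K0 in Kt.
  apply: (@le_trans _ _ (2 * J%:R * K)); first by rewrite ler_wpM2l // mulr_ge0.
  have -> : 8 * (m + 12)%:R * K * ln eps^-1 = 2 * (4 * (m + 12)%:R * ln eps^-1) * K by ring.
  by rewrite ler_wpM2r // ler_wpM2l.
apply: le_trans degK _; case: ifP => d3; last first.
  have m2F : (2 <= m)%N = false := d3.
  have mE : m = 1%N by apply/eqP; rewrite eqn_leq m0 andbT leqNgt m2F.
  rewrite /K m2F mE; apply: ler_wpM2r => //.
  have -> : 8 * (1 + 12)%:R * (2 * 1000 * 257 * 81 * 1024 / eps) =
     8 * 13 * (2 * 1000 * 257 * 81 * 1024) * eps^-1 :> R by rewrite mulrA.
  by apply: ler_wpM2r; [rewrite invr_ge0 ltW | exact: Cbig].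
have m2 : (2 <= m)%N := d3.
apply: ler_wpM2r => //.
have -> : eps `^ ((1 - m.+1%:R) / 2) = (Num.sqrt eps)^-1 ^+ m.
  have -> : (1 - m.+1%:R) / 2 = 2^-1 * - m%:R :> R by rewrite -natr1; field.
  by rewrite powRrM powR12_sqrt ?powR_invn ?exprVn // ltW.
rewrite /K m2 !mulrA; apply: ler_wpM2r; first by rewrite exprn_ge0 // invr_ge0 ltW.
have -> : 8 * (m + 12)%:R * m.+1%:R * 1000 * m%:R * 257 * 2592 ^+ m * m%:R ^+ m =
   (8 * (m + 12) * m.+1 * 1000 * m * 257 * 2592 ^ m * m ^ m)%:R :> R.
  by rewrite !natrM !natrX.
rewrite ler_nat; set d := m.+1.
apply: (@leq_trans (d ^ (20 * d))); last by rewrite leq_exp2l // leq_mul2r C20 orbT.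
exact: dimension_factor.
Qed.
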